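(* Let $n\ge4$. The circuit variety of $L_n$ has the irredundant irreducible decomposition $$V_{\mathcal{C}(L_n)}=\bigcup_{\mathcal{Q}}V_{L_n(\mathcal{Q})},$$ where the union ranges over all partitions $\mathcal{Q}=\{Q_1,\ldots,Q_k\}$ of the set $\mathcal{L}$ of lines of $L_n$ such that $|Q_i|\notin\{2,3,n-1\}$ for every $i\in[k]$.
   Context: $L_n$ is the rank-three paving matroid on the set $P$ of 2-element subsets of $[n]$ (the pairwise intersection points of $n$ general lines in $\mathbb{P}^2$), whose lines are $\ell_i=\{\{i,j\}:j\ne i\}$, $i\in[n]$, $\mathcal{L}=\{\ell_1,\ldots,\ell_n\}$; circuits are the 3-subsets of some $\ell_i$ and the 4-subsets containing no such 3-subset. For a partition $\mathcal{Q}=\{Q_1,\ldots,Q_k\}$ of $\mathcal{L}$, let $H_i=\bigcup_{\ell\in Q_i}\ell$ and let $L_n(\mathcal{Q})$ be the matroid on $P$ whose circuits are: (Type 1) 2-subsets contained in $H_i\cap H_j$ for some $i\ne j$; (Type 2) 3-subsets of some $H_i$ containing no Type 1 set; (Type 3) 4-subsets containing no Type 1 or Type 2 set. For a matroid $N$ on $P$, the circuit variety $V_{\mathcal{C}(N)}$ is the set of tuples $(\gamma_p)_{p\in P}$ in $\mathbb{C}^3$ with $(\gamma_p)_{p\in S}$ linearly dependent for every dependent $S$; a realization is a tuple with $(\gamma_p)_{p\in S}$ dependent iff $S$ is dependent in $N$, and $V_N$ is the Zariski closure of the set of realizations. Irredundant: each component is irreducible and none is contained in another. *)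

(* Defs.v *)
From HB Require Import structures.
From mathcomp Require Import all_boot all_order all_algebra.
From mathcomp Require Import complex.
From mathcomp Require Import reals.
From mathcomp Require Import mpoly.

Set Implicit Arguments.
Unset Strict Implicit.
Unset Printing Implicit Defensive.

Import Order.TTheory GRing.Theory Num.Theory.
Local Open Scope ring_scope.

Section AffineSpace.
Variables (C : fieldType) (X : finType).

Definition point := X -> C.

Definition peval (f : {mpoly C[#|X|]}) (v : point) : C :=
  f.@[fun i : 'I_#|X| => v (enum_val i)].

Definition zclosed (A : point -> Prop) : Prop :=
  exists S : {mpoly C[#|X|]} -> Prop,
    forall v, A v <-> (forall f, S f -> peval f v = 0).

Definition zclosure (A : point -> Prop) : point -> Prop :=
  fun v => forall B, zclosed B -> (forall w, A w -> B w) -> B v.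

Definition zirreducible (A : point -> Prop) : Prop :=
  (exists v, A v) /\
  forall B1 B2, zclosed B1 -> zclosed B2 ->
    (forall v, A v -> B1 v \/ B2 v) ->
    (forall v, A v -> B1 v) \/ (forall v, A v -> B2 v).

End AffineSpace.

Definition Pt (n : nat) := {A : {set 'I_n} | #|A| == 2%N}.

Definition line (n : nat) (i : 'I_n) : {set Pt n} :=
  [set p : Pt n | i \in val p].

(* a "matroid" on Pt n is given by its set of circuits, as a predicate *)
Definition circuits (n : nat) := pred {set Pt n}.

Definition dependent (n : nat) (circ : circuits n) (S : {set Pt n}) : bool :=
  [exists T : {set Pt n}, (T \subset S) && circ T].

Definition Ln_circ (n : nat) : circuits n := fun S =>
  ((#|S| == 3%N) && [exists i : 'I_n, S \subset line i]) ||
  ((#|S| == 4%N) &&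
     [forall T : {set Pt n},
        ((T \subset S) && (#|T| == 3%N)) ==> ~~ [exists i : 'I_n, T \subset line i]]).

(* A partition Q of the set of lines L = {l_1,...,l_n} is encoded as a
   partition of the index set 'I_n (lines are identified with indices). *)

Definition Hb (n : nat) (B : {set 'I_n}) : {set Pt n} :=
  \bigcup_(i in B) line i.

Definition LQ_type1 (n : nat) (Q : {set {set 'I_n}}) (S : {set Pt n}) : bool :=
  (#|S| == 2%N) &&
  [exists B1 in Q, exists B2 in Q, (B1 != B2) && (S \subset Hb B1 :&: Hb B2)].

Definition LQ_type2 (n : nat) (Q : {set {set 'I_n}}) (S : {set Pt n}) : bool :=
  (#|S| == 3%N) && [exists B in Q, S \subset Hb B] &&
  [forall T : {set Pt n}, (T \subset S) ==> ~~ LQ_type1 Q T].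

Definition LQ_type3 (n : nat) (Q : {set {set 'I_n}}) (S : {set Pt n}) : bool :=
  (#|S| == 4%N) &&
  [forall T : {set Pt n}, (T \subset S) ==> ~~ LQ_type1 Q T && ~~ LQ_type2 Q T].

Definition LQ_circ (n : nat) (Q : {set {set 'I_n}}) : circuits n := fun S =>
  [|| LQ_type1 Q S, LQ_type2 Q S | LQ_type3 Q S].

Section Varieties.
Variables (C : fieldType) (n : nat).

Definition vec (g : point C (Pt n * 'I_3)%type) (p : Pt n) : 'rV[C]_3 :=
  \row_(j < 3) g (p, j).

Definition lin_dep (g : point C (Pt n * 'I_3)%type) (S : {set Pt n}) : Prop :=
  exists c : Pt n -> C,
    (exists p, p \in S /\ c p != 0) /\ \sum_(p in S) c p *: vec g p = 0.

Definition circuit_variety (circ : circuits n) : point C (Pt n * 'I_3)%type -> Prop :=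
  fun g => forall S : {set Pt n}, dependent circ S -> lin_dep g S.

Definition realization (circ : circuits n) (g : point C (Pt n * 'I_3)%type) : Prop :=
  forall S : {set Pt n}, lin_dep g S <-> dependent circ S.

Definition matroid_variety (circ : circuits n) : point C (Pt n * 'I_3)%type -> Prop :=
  zclosure (realization circ).

End Varieties.

Definition admissible (n : nat) (Q : {set {set 'I_n}}) : bool :=
  partition Q [set: 'I_n] &&
  [forall B in Q, (#|B| != 2%N) && (#|B| != 3%N) && (#|B| != n.-1)].

(* Main.v *)
Require Import Defs.
From HB Require Import structures.
From mathcomp Require Import all_boot all_order all_algebra.
From mathcomp Require Import complex.
From mathcomp Require Import reals.
From mathcomp Require Import mpoly.
From mathcomp Require Import boolp perm ring.
Import GRing.Theory Num.Theory.
Local Open Scope ring_scope.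

(** Write a configuration in terms of an equation [lam i] for each line [l_i].
    Lines with proportional equations form the blocks of a partition [Q], and
    the configuration then lies in the image of a polynomial map [phi Q] from an
    affine space: a point on two blocks is a multiple of the cross product of the
    two equations, a point inside a block is any vector of its plane.  For every
    partition [Q] a general value of [phi Q] realizes [L_n(Q)], so the image of
    [phi Q] is dense in the irreducible variety [V_{L_n(Q)}].

    A block of size [n - 1] meets every point, so such a [Q] degenerates from the
    one-block partition.  A block of size 2 or 3 can be broken into singletons by
    perturbing the equations to first order in prescribed directions.  For the
    irredundancy, if [V_{L_n(Q)}] lies in [V_{L_n(Q')}] then comparing dependent
    sets shows that [Q'] refines [Q] and that every block of [Q] which it divides
    is divided into singletons; but four lines in distinct blocks of [Q'] satisfy
    the quadrilateral-set relation between their six intersection points, which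
    fails for six general vectors in the plane of a block of [Q].

    Density arguments only use segments in the parameter space, hence only
    polynomials in one variable. *)

Set Implicit Arguments.
Unset Strict Implicit.
Unset Printing Implicit Defensive.

(** * Cross and dot products in three-space *)

Section Vectors.
Variable C : numFieldType.
Implicit Types a b c d u v w : 'rV[C]_3.

(** Indices are added in ['I_3], hence modulo 3, so one formula covers all three coordinates. *)
Definition cross a b : 'rV[C]_3 :=
  \row_k (a 0 (k + 1) * b 0 (k + 2%:R) - a 0 (k + 2%:R) * b 0 (k + 1)).

Definition dot a b : C := \sum_k a 0 k * b 0 k.

Lemma ord3P (k : 'I_3) : [\/ k = 0, k = 1 | k = 2%:R].
Proof.
by case: k => [[|[|[|//]]]] i; [constructor 1|constructor 2|constructor 3]; apply: val_inj.
Qed.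

Lemma row3P a b :
  a 0 0 = b 0 0 -> a 0 1 = b 0 1 -> a 0 2%:R = b 0 2%:R -> a = b.
Proof.
by move=> h0 h1 h2; apply/rowP => k; case: (ord3P k) => ->.
Qed.

Lemma crossE a b :
  (cross a b 0 0 = a 0 1 * b 0 2%:R - a 0 2%:R * b 0 1) *
  (cross a b 0 1 = a 0 2%:R * b 0 0 - a 0 0 * b 0 2%:R) *
  (cross a b 0 2%:R = a 0 0 * b 0 1 - a 0 1 * b 0 0).
Proof.
split; [split|]; rewrite mxE.
- by rewrite !add0r.
- have -> : 1 + 1 = 2%:R :> 'I_3 by apply: val_inj.
  by have -> : 1 + 2%:R = 0 :> 'I_3 by apply: val_inj.
- have -> : 2%:R + 1 = 0 :> 'I_3 by apply: val_inj.
  by have -> : 2%:R + 2%:R = 1 :> 'I_3 by apply: val_inj.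
Qed.

Lemma dotE a b : dot a b = a 0 0 * b 0 0 + a 0 1 * b 0 1 + a 0 2%:R * b 0 2%:R.
Proof.
rewrite /dot !big_ord_recl big_ord0 addr0 addrA.
have -> : lift ord0 ord0 = 1 :> 'I_3 by apply: val_inj.
by have -> : lift ord0 (lift ord0 ord0) = 2%:R :> 'I_3 by apply: val_inj.
Qed.

Lemma coordE (k : 'I_3) :
  (forall a b, (a + b) 0 k = a 0 k + b 0 k) *
  (forall a, (- a) 0 k = - a 0 k) *
  (forall r a, (r *: a) 0 k = r * a 0 k) *
  ((0 : 'rV[C]_3) 0 k = 0).
Proof. by split; [split; [split|]|] => *; rewrite mxE. Qed.

Ltac vring := try apply: row3P; rewrite ?(coordE, crossE, dotE); ring.

Lemma dotC a b : dot a b = dot b a.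
Proof. vring. Qed.

Lemma crossC a b : cross a b = - cross b a.
Proof. vring. Qed.

Lemma cross_self a : cross a a = 0.
Proof. vring. Qed.

Lemma cross0l b : cross 0 b = 0.
Proof. vring. Qed.

Lemma crossDr a b c : cross a (b + c) = cross a b + cross a c.
Proof. vring. Qed.

Lemma crossZl k a b : cross (k *: a) b = k *: cross a b.
Proof. vring. Qed.

Lemma crossZr k a b : cross a (k *: b) = k *: cross a b.
Proof. vring. Qed.

Lemma crossNr a b : cross a (- b) = - cross a b.
Proof. vring. Qed.

Lemma dotZl k a b : dot (k *: a) b = k * dot a b.
Proof. vring. Qed.

Lemma dotZr k a b : dot a (k *: b) = k * dot a b.
Proof. vring. Qed.

Lemma dotNr a b : dot a (- b) = - dot a b.
Proof. vring. Qed.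

Lemma dot_cross_l a b : dot a (cross a b) = 0.
Proof. vring. Qed.

Lemma dot_cross_r a b : dot b (cross a b) = 0.
Proof. vring. Qed.

Lemma cross_cross a b c : cross a (cross b c) = dot a c *: b - dot a b *: c.
Proof. vring. Qed.

(** Vectors of the plane with equation [a] are written [cross a b]. For nonzero [a], two of them are
    parallel exactly when the determinant of [a], [b], [c] vanishes. *)
Lemma cross_cross_pivot a b c :
  cross (cross a b) (cross a c) = dot a (cross b c) *: a.
Proof. vring. Qed.

Lemma dot_cross_cross z a b c :
  dot z (cross (cross a c) (cross b c)) = dot a (cross b c) * dot z c.
Proof. vring. Qed.

(** By Cramer's rule the combination is [a] times the determinant of [x], [y], [z]. *)
Lemma cross_cramer a x y z :
  cross a (dot a (cross y z) *: x + dot a (cross z x) *: y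
           + dot a (cross x y) *: z) = 0.
Proof. vring. Qed.

(** The order-zero term is [cross a a], so the product is divisible by [s]; after division its value
    at [s = 0] is [cross a (w - v)]. *)
Lemma cross_perturb a v w s : cross (a + s *: v) (a + s *: w) =
  s *: cross a (w - v) + s *: (s *: cross v w).
Proof. vring. Qed.

(* The pencil joining [z] to the six vertices of a complete quadrilateral is a
   quadrilateral set: each bracket is a maximal minor of the four lines times
   the value of one of the lines at [z]. *)
Lemma quadrilateral_relation z l1 l2 l3 l4 t12 t13 t14 t23 t24 t34 :
  let p12 := t12 *: cross l1 l2 in let p13 := t13 *: cross l1 l3 in
  let p14 := t14 *: cross l1 l4 in let p23 := t23 *: cross l2 l3 in
  let p24 := t24 *: cross l2 l4 in let p34 := t34 *: cross l3 l4 in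
  dot z (cross p23 p13) * dot z (cross p34 p14) * dot z (cross p24 p12) =
  dot z (cross p23 p12) * dot z (cross p34 p13) * dot z (cross p24 p14).
Proof.
rewrite /= !crossZl !crossZr !dotZr.
have perm_det a b c : dot b (cross a c) = - dot a (cross b c) by vring.
have cycr a b c : dot z (cross (cross b c) (cross a b)) =
                  - dot a (cross b c) * dot z b by vring.
rewrite !dot_cross_cross !cycr !(perm_det l1); ring.
Qed.

Lemma rV3_neq0 a : a != 0 -> exists k, a 0 k != 0.
Proof.
move=> a0; apply: contrapT => h; case/eqP: a0; apply/rowP => k; rewrite mxE.
by apply/eqP; apply: contrapT => /negP hk; apply: h; exists k.
Qed.

Lemma dot_delta a k : dot a (delta_mx 0 k) = a 0 k.
Proof.
rewrite /dot (bigD1 k) //= big1 ?addr0 => [|j jk]; rewrite mxE ?eqxx ?mulr1 //.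
by rewrite (negbTE jk) andbF mulr0.
Qed.

Lemma dot_solve a w : a != 0 -> dot a w = 0 -> exists u, cross a u = w.
Proof.
(* As [dot a w = 0], the product [cross a (cross b w)] equals [- dot a b *: w], so any [b] with
   [dot a b = -1] works; here it is a rescaled basis vector. *)
move=> /rV3_neq0[k ak] aw; exists (cross (- (a 0 k)^-1 *: delta_mx 0 k) w).
rewrite cross_cross aw scale0r add0r dotZr dot_delta mulNr mulVf //.
by rewrite scaleN1r opprK.
Qed.

Lemma cross_eq0 a b : b != 0 -> cross a b = 0 -> exists k, a = k *: b.
Proof.
move=> b0 ab0; have [k bk] := rV3_neq0 b0; exists (a 0 k / b 0 k).
have e0 : a 0 1 * b 0 2%:R = a 0 2%:R * b 0 1.
  by apply/eqP; rewrite -subr_eq0 -!crossE ab0 mxE.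
have e1 : a 0 2%:R * b 0 0 = a 0 0 * b 0 2%:R.
  by apply/eqP; rewrite -subr_eq0 -!crossE ab0 mxE.
have e2 : a 0 0 * b 0 1 = a 0 1 * b 0 0.
  by apply/eqP; rewrite -subr_eq0 -!crossE ab0 mxE.
apply/rowP => j; rewrite !mxE; apply: (mulIf bk); rewrite mulrAC divfK //.
by case: (ord3P j) => ->; case: (ord3P k) => ->.
Qed.

Lemma ortho_cross a b w :
  cross a b != 0 -> dot a w = 0 -> dot b w = 0 -> exists k, w = k *: cross a b.
Proof.
move=> ab aw bw; apply: cross_eq0 => //.
by rewrite cross_cross ![dot w _]dotC aw bw !scale0r subrr.
Qed.

Lemma cross_delta a b k : a 0 k = 0 -> b 0 k = 0 ->
  cross a b = (a 0 (k + 1) * b 0 (k + 2%:R) - a 0 (k + 2%:R) * b 0 (k + 1))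
              *: delta_mx 0 k.
Proof.
move=> ak bk; apply/rowP => j.
rewrite [RHS]mxE [delta_mx _ _ _ _]mxE eqxx /=.
have [->|jk] := eqVneq j k; first by rewrite mulr1 mxE.
rewrite mulr0 mxE.
have [/eqP|e|e] := ord3P (k - j).
- by rewrite subr_eq0 eq_sym (negbTE jk).
- have -> : j + 1 = k by rewrite -e addrC subrK.
  by rewrite ak bk mulr0 mul0r subrr.
- have -> : j + 2%:R = k by rewrite -e addrC subrK.
  by rewrite ak bk mulr0 mul0r subrr.
Qed.

End Vectors.

(** * Algebras of functions *)

Section FunctionAlgebras.
Variables (C : numFieldType) (T : Type).

(** The class [F] is abstract so that polynomial functions of one variable and regular functions on
    configurations share the same closure lemmas. *)
Record fun_algebra (F : (T -> C) -> Prop) : Prop := FunAlgebra {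
  fun_algebra_const : forall c, F (fun=> c);
  fun_algebraD : forall f g, F f -> F g -> F (fun x => f x + g x);
  fun_algebraM : forall f g, F f -> F g -> F (fun x => f x * g x) }.

Variables (F : (T -> C) -> Prop) (FA : fun_algebra F).

Lemma fun_algebraN f : F f -> F (fun x => - f x).
Proof.
move=> Ff; have -> : (fun x => - f x) = (fun x => -1 * f x).
  by apply/funext => x; rewrite mulN1r.
by apply: (fun_algebraM FA) => //; apply: (fun_algebra_const FA).
Qed.

Lemma fun_algebra_sum I (r : seq I) (P : pred I) (f : I -> T -> C) :
  (forall i, F (f i)) -> F (fun x => \sum_(i <- r | P i) f i x).
Proof.
move=> Ff; elim: r => [|i r IH].
  rewrite (_ : (fun x => _) = (fun=> 0)); first exact: (fun_algebra_const FA).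
  by apply/funext => x; rewrite big_nil.
rewrite (_ : (fun x => _) =
    (fun x => (P i)%:R * f i x + \sum_(j <- r | P j) f j x)).
  apply: (fun_algebraD FA) => //; apply: (fun_algebraM FA) => //.
  exact: (fun_algebra_const FA).
by apply/funext => x; rewrite big_cons; case: ifP; rewrite ?mul1r ?mul0r ?add0r.
Qed.

Lemma fun_algebra_prod I (r : seq I) (P : pred I) (f : I -> T -> C) :
  (forall i, F (f i)) -> F (fun x => \prod_(i <- r | P i) f i x).
Proof.
move=> Ff; elim: r => [|i r IH].
  rewrite (_ : (fun x => _) = (fun=> 1)); first exact: (fun_algebra_const FA).
  by apply/funext => x; rewrite big_nil.
rewrite (_ : (fun x => _) =
    (fun x => (if P i then f i x else 1) * \prod_(j <- r | P j) f j x)).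
  by apply: (fun_algebraM FA) => //; case: (P i) => //; apply: (fun_algebra_const FA).
by apply/funext => x; rewrite big_cons; case: ifP; rewrite ?mul1r.
Qed.

Lemma fun_algebraX f n : F f -> F (fun x => f x ^+ n).
Proof.
move=> Ff; rewrite (_ : (fun x => _) = (fun x => \prod_(i < n) f x)).
  exact: (@fun_algebra_prod _ _ _ (fun=> f)).
by apply/funext => x; rewrite prodr_const card_ord.
Qed.

Lemma fun_algebra_det m (A : T -> 'M[C]_m) :
  (forall i j, F (fun x => A x i j)) -> F (fun x => \det (A x)).
Proof.
move=> FA'; rewrite /determinant.
apply: (@fun_algebra_sum _ _ _ (fun (s : 'S_m) x =>
  (-1) ^+ s * \prod_i A x i (s i))) => s.
apply: (fun_algebraM FA); first exact: (fun_algebra_const FA).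
exact: (@fun_algebra_prod _ _ _ (fun i x => A x i (s i))).
Qed.

Lemma fun_algebra_mulmx m p q (A : T -> 'M[C]_(m, p)) (B : 'M_(p, q)) :
  (forall i j, F (fun x => A x i j)) ->
  forall i j, F (fun x => (A x *m B) i j).
Proof.
move=> FA' i j; rewrite (_ : (fun x => _) = (fun x => \sum_k A x i k * B k j)).
  apply: (@fun_algebra_sum _ _ _ (fun k x => A x i k * B k j)) => k.
  by apply: (fun_algebraM FA) => //; apply: (fun_algebra_const FA).
by apply/funext => x; rewrite mxE.
Qed.

Definition vec_in (w : T -> 'rV[C]_3) := forall k, F (fun x => w x 0 k).

Lemma vec_in_const w : vec_in (fun=> w).
Proof. by move=> k; apply: (fun_algebra_const FA).
Qed.

Lemma vec_inD v w : vec_in v -> vec_in w -> vec_in (fun x => v x + w x).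
Proof.
move=> Fv Fw k; rewrite (_ : (fun x => _) = (fun x => v x 0 k + w x 0 k)).
  exact: (fun_algebraD FA).
by apply/funext => x; rewrite mxE.
Qed.

Lemma vec_inZ f v : F f -> vec_in v -> vec_in (fun x => f x *: v x).
Proof.
move=> Ff Fv k; rewrite (_ : (fun x => _) = (fun x => f x * v x 0 k)).
  exact: (fun_algebraM FA).
by apply/funext => x; rewrite mxE.
Qed.

Lemma vec_in_cross v w : vec_in v -> vec_in w -> vec_in (fun x => cross (v x) (w x)).
Proof.
move=> Fv Fw k; rewrite (_ : (fun x => _) =
  (fun x => v x 0 (k + 1) * w x 0 (k + 2%:R) +
            - (v x 0 (k + 2%:R) * w x 0 (k + 1)))).
  apply: (fun_algebraD FA); first exact: (fun_algebraM FA).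
  apply: (fun_algebraN (f := fun x => v x 0 (k + 2%:R) * w x 0 (k + 1))).
  exact: (fun_algebraM FA).
by apply/funext => x; rewrite mxE.
Qed.

Lemma fun_algebra_dot v w :
  vec_in v -> vec_in w -> F (fun x => dot (v x) (w x)).
Proof. move=> Fv Fw.
apply: (@fun_algebra_sum _ _ _ (fun k x => v x 0 k * w x 0 k)) => k.
exact: (fun_algebraM FA).
Qed.

End FunctionAlgebras.

(** * Polynomial functions of one variable and generic parameters *)

Section PolynomialFunctions.
Variable C : numFieldType.

Definition polyfun (h : C -> C) := exists p : {poly C}, forall s, h s = p.[s].

Lemma polyfun_algebra : fun_algebra polyfun.
Proof.
split=> [c|f g [p fp] [q gq]|f g [p fp] [q gq]].
- by exists c%:P => s; rewrite hornerC.
- by exists (p + q) => s; rewrite hornerD fp gq.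
- by exists (p * q) => s; rewrite hornerM fp gq.
Qed.

Lemma polyfun_id : polyfun id.
Proof. by exists 'X => s; rewrite hornerX. Qed.

(** In characteristic zero the integers below [size p] are distinct, and they are more numerous than
    the roots of a nonzero [p]. *)
Lemma horner_neq0 (p : {poly C}) : p != 0 -> exists s, p.[s] != 0.
Proof.
move=> p0; apply: contrapT => h; case/eqP: p0.
apply: (@roots_geq_poly_eq0 _ p [seq i%:R | i <- iota 0 (size p)]).
- apply/allP => x /mapP[i _ ->]; apply/eqP; apply: contrapT => /eqP pi.
  by apply: h; exists i%:R.
- by rewrite map_inj_uniq ?iota_uniq // => i j /eqP; rewrite eqr_nat => /eqP.
- by rewrite size_map size_iota.
Qed.

(** Genericity on the affine line, with the exceptional values among the roots of one polynomial;
    conjunctions multiply these polynomials. *)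
Definition for_almost_all (P : C -> Prop) :=
  exists2 p : {poly C}, p != 0 & forall s, p.[s] != 0 -> P s.

Lemma almost_all_ex P : for_almost_all P -> exists s, P s.
Proof. by case=> p /horner_neq0[s ps] h; exists s; apply: h. Qed.

Lemma almost_all_mono (P P' : C -> Prop) :
  (forall s, P s -> P' s) -> for_almost_all P -> for_almost_all P'.
Proof. by move=> h [p p0 hp]; exists p => // s /hp/h. Qed.

Lemma almost_all_and P P' : for_almost_all P -> for_almost_all P' ->
  for_almost_all (fun s => P s /\ P' s).
Proof.
move=> [p p0 hp] [q q0 hq]; exists (p * q); first by rewrite mulf_neq0.
by move=> s; rewrite hornerM mulf_eq0 negb_or => /andP[/hp ? /hq].
Qed.

Lemma almost_all_seq (I : eqType) (r : seq I) (P : I -> C -> Prop) :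
  (forall i, i \in r -> for_almost_all (P i)) ->
  for_almost_all (fun s => forall i, i \in r -> P i s).
Proof.
elim: r => [_|i r IH hr].
  by exists 1; rewrite ?oner_eq0.
have hi := hr i (mem_head _ _).
have {}IH : for_almost_all (fun s => forall i, i \in r -> P i s).
  by apply: IH => j jr; apply: hr; rewrite in_cons jr orbT.
apply: almost_all_mono (almost_all_and hi IH) => s [Pi Pr] j.
by rewrite in_cons => /orP[/eqP->|/Pr].
Qed.

Lemma almost_all_fin (I : finType) (P : I -> C -> Prop) :
  (forall i, for_almost_all (P i)) ->
  for_almost_all (fun s => forall i, P i s).
Proof.
move=> h; apply: almost_all_mono (almost_all_seq (r := enum I) (fun i _ => h i)).
by move=> s hs i; apply: hs; rewrite mem_enum.
Qed.

Lemma polyfun_almost_all h s0 :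
  polyfun h -> h s0 != 0 -> for_almost_all (fun s => h s != 0).
Proof.
case=> p hp; rewrite hp => ps0; exists p => [|s]; last by rewrite hp.
by apply: contraNneq ps0 => ->; rewrite horner0.
Qed.

Lemma almost_all_neq0 : for_almost_all (fun s => s != 0).
Proof.
by apply: (@polyfun_almost_all _ 1) polyfun_id _; rewrite oner_neq0.
Qed.

End PolynomialFunctions.

(** * Zariski closure along polynomial curves, and irreducibility *)

Section Closure.
Variables (C : numFieldType) (X : finType).
Implicit Types A B : point C X -> Prop.

Definition regular (h : point C X -> C) :=
  exists f : {mpoly C[#|X|]}, forall v, peval f v = h v.

Lemma regular_algebra : fun_algebra regular.
Proof.
split=> [c|f g [p fp] [q gq]|f g [p fp] [q gq]].
- by exists c%:MP => s; rewrite /peval mevalC.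
- by exists (p + q) => s; rewrite -fp -gq /peval mevalD.
- by exists (p * q) => s; rewrite -fp -gq /peval mevalM.
Qed.

Lemma regular_coord i : regular (fun v => v i).
Proof. by exists 'X_(enum_rank i) => v; rewrite /peval mevalXU enum_rankK. Qed.

Lemma zclosed_regular (I : Type) (h : I -> point C X -> C) :
  (forall i, regular (h i)) -> zclosed (fun v => forall i, h i v = 0).
Proof.
move=> hr; exists (fun f => exists i, forall v, peval f v = h i v) => v.
split=> [hv f [i fi]|hv i]; first by rewrite fi.
by have [f fi] := hr i; rewrite -fi; apply: hv; exists i.
Qed.

Definition curve (g : C -> point C X) := forall i, polyfun (fun s => g s i).

Lemma polyfun_peval f g : curve g -> polyfun (fun s => peval f (g s)).
Proof.
move=> cg; have FA := polyfun_algebra C.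
rewrite (_ : (fun s => _) = fun s => \sum_(m <- msupp f)
     f@_m * \prod_(i < #|X|) g s (enum_val i) ^+ m i).
  apply: (@fun_algebra_sum _ _ _ FA _ _ _ (fun (m : 'X_{1..#|X|}) s =>
     f@_m * \prod_(i < #|X|) g s (enum_val i) ^+ m i)) => // m; apply: (fun_algebraM FA) => //.
    exact: (fun_algebra_const FA).
  apply: (@fun_algebra_prod _ _ _ FA _ _ _ (fun i s => g s (enum_val i) ^+ m i)) => i.
  exact: (fun_algebraX FA).
by apply/funext => s; rewrite /peval mevalE.
Qed.

Lemma zclosureS A B v : zclosed B -> (forall w, A w -> B w) ->
  zclosure A v -> B v.
Proof. by move=> cB AB; apply. Qed.

Lemma zclosureW A v : A v -> zclosure A v.
Proof. by move=> Av B _; apply. Qed.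

(** An equation of a closed set containing [A] restricts to a one-variable polynomial on the curve.
    It vanishes at almost all parameters, hence identically, so limits along the curve stay in the
    closure. *)
Lemma zclosure_curve A g : curve g ->
  for_almost_all (fun s => zclosure A (g s)) -> forall s, zclosure A (g s).
Proof.
move=> cg [q q0 hq] s B [S BS] AB; apply/BS => f Sf.
have [p hp] := polyfun_peval f cg.
suff p0 : p = 0 by rewrite hp p0 horner0.
apply/eqP; apply: contrapT => /negP p0.
have /horner_neq0[r] : p * q != 0 by rewrite mulf_neq0.
rewrite hornerM mulf_eq0 negb_or -hp => /andP[/eqP fr /hq gr]; apply: fr.
by have /BS/(_ f Sf) : B (g r) by apply: gr => //; exists S.
Qed.

(** If [v] escapes [B1] and [w] escapes [B2], an equation of each restricts to a nonzero polynomial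
    on the joining curve; a common non-root gives a point of the closure outside both. *)
Lemma zirreducible_segment A :
  (exists v, A v) ->
  (forall v w, A v -> A w -> exists g, [/\ curve g, exists s, g s = v,
    exists s, g s = w & forall s, zclosure A (g s)]) ->
  zirreducible (zclosure A).
Proof.
move=> [v0 Av0] conn; split; first by exists v0; apply: zclosureW.
move=> B1 B2 cB1 cB2 cov.
have [] : (forall v, A v -> B1 v) \/ (forall v, A v -> B2 v); last first.
- by move=> AB; right => v; apply: zclosureS.
- by move=> AB; left => v; apply: zclosureS.
apply: contrapT => /not_orP[/existsNP[v /not_implyP[Av nv]]
                            /existsNP[w /not_implyP[Aw nw]]].
have [g [cg [s1 gs1] [s2 gs2] gA]] := conn v w Av Aw.
have [S1 BS1] := cB1; have [S2 BS2] := cB2.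
have [f1 /not_implyP[Sf1 /eqP f1v]] : exists f, ~ (S1 f -> peval f v = 0).
  by apply/existsNP => h; apply/nv/BS1.
have [f2 /not_implyP[Sf2 /eqP f2w]] : exists f, ~ (S2 f -> peval f w = 0).
  by apply/existsNP => h; apply/nw/BS2.
rewrite -gs1 in f1v; rewrite -gs2 in f2w.
have [s [/eqP h1 /eqP h2]] := almost_all_ex (almost_all_and
  (polyfun_almost_all (polyfun_peval f1 cg) f1v)
  (polyfun_almost_all (polyfun_peval f2 cg) f2w)).
by case: (cov _ (gA s)) => [/BS1/(_ f1 Sf1)|/BS2/(_ f2 Sf2)].
Qed.

End Closure.

(** * Linear dependence as a closed condition *)

Section LinearDependence.
Variables (C : numFieldType) (n : nat).
Implicit Types (g : point C (Pt n * 'I_3)%type) (S : {set Pt n}).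

Definition vmx g S : 'M[C]_(#|S|, 3) := \matrix_(k, j) g (enum_val k, j).

Lemma row_vmx g S k : row k (vmx g S) = vec g (enum_val k).
Proof. by apply/rowP => j; rewrite !mxE. Qed.

Lemma mulmx_vmx g S (c : Pt n -> C) :
  (\row_k c (enum_val k)) *m vmx g S = \sum_(p in S) c p *: vec g p.
Proof.
rewrite mulmx_sum_row [RHS]big_enum_val; apply: eq_bigr => k _.
by rewrite row_vmx mxE.
Qed.

Lemma lin_depP g S : lin_dep g S <-> ~~ row_free (vmx g S).
Proof.
split=> [[c [[p [pS cp]] sum0]]|nf].
  apply/negP => /row_free_inj inj.
  have /inj/rowP/(_ (enum_rank_in pS p)) :
      (\row_k c (enum_val k)) *m vmx g S = 0 *m vmx g S.
    by rewrite mulmx_vmx sum0 mul0mx.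
  by rewrite !mxE enum_rankK_in // => /eqP; rewrite (negbTE cp).
move: nf; rewrite -kermx_eq0 => /rowV0Pn[v vk v0].
have [k vk0] : exists k, v 0 k != 0.
  apply: contrapT => h; case/eqP: v0; apply/rowP => k; rewrite mxE.
  by apply/eqP; apply: contrapT => /negP hk; apply: h; exists k.
(* Row coefficients are carried back to points; a point outside [S] gets the default 0. *)
pose c p := if [pick k | enum_val k == p :> Pt n] is Some k then v 0 k else 0.
have cE (i : 'I_#|S|) : c (enum_val i) = v 0 i.
  rewrite /c; case: pickP => [j /eqP/enum_val_inj->//|/(_ i)].
  by rewrite eqxx.
exists c; split; first by exists (enum_val k); rewrite enum_valP cE.
rewrite -mulmx_vmx (_ : \row_k _ = v); last by apply/rowP => i; rewrite mxE cE.
exact/sub_kermxP.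
Qed.

(** Quantifying over [B] replaces the choice of a maximal minor, so independence is the nonvanishing
    of some polynomial in the entries of [A]. *)
Lemma row_free_det (m : nat) (A : 'M[C]_(m, 3)) :
  row_free A <-> exists B, \det (A *m B) != 0.
Proof.
split=> [/row_freeP[B AB]|[B AB]].
  by exists B; rewrite AB det1 oner_neq0.
apply/row_freeP; exists (B *m invmx (A *m B)).
by rewrite mulmxA mulmxV // unitmxE unitfE.
Qed.

Lemma zclosed_lin_dep S : zclosed (fun g => lin_dep g S).
Proof.
have -> : (fun g => lin_dep g S) =
    (fun g => forall B, \det (vmx g S *m B) = 0).
  apply/funext => g; apply/propext; split=> [/lin_depP/negP nf B|nf].
    by apply/eqP; apply: contrapT => /negP h; apply/nf/row_free_det; exists B.
  by apply/lin_depP/negP => /row_free_det[B]; rewrite nf eqxx.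
have FA := regular_algebra C (Pt n * 'I_3)%type.
apply: zclosed_regular => B; apply: (fun_algebra_det FA).
apply: (fun_algebra_mulmx FA).
move=> i j; rewrite (_ : (fun x => _) = fun x => x (enum_val i, j)).
  exact: regular_coord.
by apply/funext => x; rewrite mxE.
Qed.

Lemma almost_all_lin_indep (g : C -> point C (Pt n * 'I_3)%type) S s0 :
  curve g -> ~ lin_dep (g s0) S -> for_almost_all (fun s => ~ lin_dep (g s) S).
Proof.
move=> cg /lin_depP/negP; rewrite negbK => /row_free_det[B hB].
have FA := polyfun_algebra C.
have /polyfun_almost_all/(_ hB) : polyfun (fun s => \det (vmx (g s) S *m B)).
  apply: (fun_algebra_det FA); apply: (fun_algebra_mulmx FA) => i j.
  rewrite (_ : (fun s => _) = fun s => g s (enum_val i, j)) //.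
  by apply/funext => s; rewrite mxE.
apply: almost_all_mono => s hs; apply/lin_depP/negP; rewrite negbK.
by apply/row_free_det; exists B.
Qed.

Lemma lin_depS g S S' : S \subset S' -> lin_dep g S -> lin_dep g S'.
Proof.
move=> SS' [c [[p [pS cp]] sum0]].
exists (fun q => if q \in S then c q else 0); split.
  by exists p; rewrite pS (subsetP SS').
rewrite -[RHS]sum0 (big_setID S) /= (setIidPr SS') [X in _ + X]big1 ?addr0.
  by apply: eq_bigr => q ->.
by move=> q; rewrite inE => /andP[/negbTE->]; rewrite scale0r.
Qed.

Lemma lin_dep_card g S : (3 < #|S|)%N -> lin_dep g S.
Proof.
move=> S4; apply/lin_depP; rewrite /row_free neq_ltn.
by rewrite (leq_ltn_trans (rank_leq_col _)).
Qed.

(** Independent rows would give full column rank 3, and such a matrix cannot kill the nonzero vector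
    [a]. *)
Lemma lin_dep_plane g S a : a != 0 -> (2 < #|S|)%N ->
  (forall p, p \in S -> dot a (vec g p) = 0) -> lin_dep g S.
Proof.
move=> a0 S3 aS; apply/lin_depP/negP => rf.
have vS : vmx g S *m a^T = 0.
  apply/colP => k; rewrite !mxE -[RHS](aS _ (enum_valP k)) dotC /dot.
  by apply: eq_bigr => j _; rewrite !mxE.
have full : row_full (vmx g S).
  by rewrite /row_full eqn_leq rank_leq_col (eqP rf).
by case/eqP: a0; apply: trmx_inj; rewrite trmx0; apply: (row_full_inj full); rewrite vS mulmx0.
Qed.

Lemma lin_dep_pair g p q : p != q -> cross (vec g p) (vec g q) = 0 ->
  lin_dep g [set p; q].
Proof.
move=> pq; have [q0|q0 /cross_eq0[//|k pk]] := eqVneq (vec g q) 0.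
  move=> _; exists (fun r => (r == q)%:R); split.
    by exists q; rewrite !inE eqxx orbT oner_neq0.
  by rewrite big_setU1 ?inE //= big_set1 q0 scaler0 (negbTE pq) scale0r addr0.
exists (fun r => if r == q then k else -1); split.
  by exists p; rewrite !inE eqxx (negbTE pq) oppr_eq0 oner_neq0.
by rewrite big_setU1 ?inE //= big_set1 eqxx (negbTE pq) pk scaleN1r addNr.
Qed.

(** If the vectors spanned the space, three of them would form a basis; otherwise the kernel of the
    transposed matrix contains the required equation. *)
Lemma plane_of_lin_dep g (S : {set Pt n}) :
  (forall T : {set Pt n}, T \subset S -> #|T| = 3 -> lin_dep g T) ->
  exists2 a, a != 0 & forall p, p \in S -> dot a (vec g p) = 0.
Proof.
move=> dep.
have : ~~ row_full (vmx g S).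
  apply/negP => full; pose f := fullrankfun full.
  pose T := [set enum_val (f k) | k : 'I_3].
  have injf : injective (fun k => enum_val (f k)).
    by move=> k l /enum_val_inj/fullrankfun_inj.
  have [c [[p [/imsetP[k _ ->] ck]]]] : lin_dep g T.
    apply: dep; last by rewrite card_imset ?card_ord.
    by apply/subsetP => _ /imsetP[k _ ->]; apply: enum_valP.
  rewrite big_imset /=; last by move=> ? ? _ _; apply: injf.
  move=> sum0; have /row_free_inj inj := fullrowsub_free full.
  have /inj/rowP/(_ k) : (\row_k c (enum_val (f k))) *m rowsub f (vmx g S)
      = 0 *m rowsub f (vmx g S).
    rewrite mul0mx -[RHS]sum0 mulmx_sum_row; apply: eq_bigr => l _.
    by rewrite row_rowsub row_vmx mxE.
  by rewrite !mxE => /eqP; rewrite (negbTE ck).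
rewrite /row_full -mxrank_tr -/(row_free _) -kermx_eq0 => /rowV0Pn[a /sub_kermxP aS a0].
exists a => // p pS; move/rowP/(_ (enum_rank_in pS p)): aS.
rewrite !mxE => aS; rewrite -[RHS]aS; apply: eq_bigr => j _.
by rewrite !mxE enum_rankK_in.
Qed.

End LinearDependence.

(** * The two lines through a point *)

Section Endpoints.
Variable n : nat.
Implicit Types p q : Pt n.

(** The ends are ordered by enumeration; this arbitrary orientation causes the sign cases that
    follow. *)
Definition end1 p : 'I_n := enum_val (cast_ord (esym (eqP (valP p))) ord0).
Definition end2 p : 'I_n := enum_val (cast_ord (esym (eqP (valP p))) ord_max).

Lemma end_neq p : end1 p != end2 p.
Proof. by apply/eqP => /enum_val_inj/cast_ord_inj. Qed.

Lemma val_ends p : val p = [set end1 p; end2 p].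
Proof.
apply/esym/eqP; rewrite eqEcard subUset !sub1set !enum_valP /=.
by rewrite cards2 end_neq (eqP (valP p)).
Qed.

Lemma mem_ends i p : (i \in val p) = (i == end1 p) || (i == end2 p).
Proof. by rewrite val_ends !inE. Qed.

Lemma Pt_ex (i j : 'I_n) : i != j -> exists p : Pt n, val p = [set i; j].
Proof.
move=> ij; have h : #|[set i; j]| == 2 by rewrite cards2 ij.
by exists (exist _ [set i; j] h).
Qed.

Lemma ends_set2 p (i j : 'I_n) : val p = [set i; j] ->
  (end1 p = i /\ end2 p = j) \/ (end1 p = j /\ end2 p = i).
Proof.
move=> pij; have := end_neq p.
have : end1 p \in val p by rewrite mem_ends eqxx.
have : end2 p \in val p by rewrite mem_ends eqxx orbT.
rewrite pij !inE => /orP[]/eqP-> /orP[]/eqP->; rewrite ?eqxx //; by auto.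
Qed.

End Endpoints.

(** * Blocks of a partition and independent sets of [L_n(Q)] *)

Section Blocks.
Variables (n : nat) (Q : {set {set 'I_n}}).
Hypothesis hQ : partition Q [set: 'I_n].
Implicit Types (p q : Pt n) (S T : {set Pt n}) (B : {set 'I_n}).

Definition blk1 (Q' : {set {set 'I_n}}) p := pblock Q' (end1 p).
Definition blk2 (Q' : {set {set 'I_n}}) p := pblock Q' (end2 p).

Lemma pblock_in i : pblock Q i \in Q.
Proof. by rewrite pblock_mem // (cover_partition hQ) inE. Qed.

Lemma mem_block B i : B \in Q -> (i \in B) = (pblock Q i == B).
Proof.
move=> BQ; apply/idP/eqP => [iB|<-].
  by apply: def_pblock => //; case/and3P: hQ.
by rewrite mem_pblock (cover_partition hQ) inE.
Qed.

Lemma mem_pblock_self i : i \in pblock Q i.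
Proof. by rewrite (mem_block _ (pblock_in i)). Qed.

Lemma mem_Hb_ends B p : (p \in Hb B) = (end1 p \in B) || (end2 p \in B).
Proof.
apply/bigcupP/orP => [[i iB]|].
  by rewrite inE mem_ends => /orP[]/eqP<-; [left|right].
by case=> h; [exists (end1 p)|exists (end2 p)]; rewrite // inE mem_ends eqxx ?orbT.
Qed.

Lemma mem_Hb B p : B \in Q -> (p \in Hb B) = (blk1 Q p == B) || (blk2 Q p == B).
Proof. by move=> BQ; rewrite mem_Hb_ends !mem_block. Qed.

Lemma card_subset_ex (T0 : finType) (S : {set T0}) k : (k <= #|S|)%N ->
  exists T : {set T0}, T \subset S /\ #|T| = k.
Proof.
move=> kS; exists [set x in take k (enum S)]; split.
  by apply/subsetP => x; rewrite inE => /mem_take; rewrite mem_enum.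
rewrite cardsE (card_uniqP _) ?take_uniq ?enum_uniq // size_take -cardE.
by case: ltngtP kS => // ->.
Qed.

(** The minimality clauses of the circuit types disappear: a set violating one of the three
    conditions contains a circuit of that type or of an earlier one. *)
Lemma LQ_independentP S :
  ~~ dependent (LQ_circ Q) S <->
  [/\ (#|S| <= 3)%N,
      forall p q B1 B2, p \in S -> q \in S -> p != q -> B1 \in Q -> B2 \in Q ->
        B1 != B2 -> ~ [/\ p \in Hb B1, p \in Hb B2, q \in Hb B1 & q \in Hb B2]
    & #|S| = 3 -> forall B, B \in Q -> ~~ (S \subset Hb B)].
Proof.
split=> [nd|[c3 h2 h3]]; last first.
  apply/existsP => -[T /andP[TS /or3P cT]]; case: cT.
  - rewrite /LQ_type1 => /andP[/cards2P[p [q [pq ET]]] /exists_inP[B1 B1Q]].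
    case/exists_inP=> B2 B2Q /andP[B12 /subsetP sub].
    have pT : p \in T by rewrite ET !inE eqxx.
    have qT : q \in T by rewrite ET !inE eqxx orbT.
    apply: (h2 p q B1 B2); rewrite ?(subsetP TS) //.
    by move: (sub p pT) (sub q qT); rewrite !inE => /andP[-> ->] /andP[-> ->].
  - rewrite /LQ_type2 => /andP[/andP[/eqP T3 /exists_inP[B BQ sub]] _].
    have ST : S = T by apply/esym/eqP; rewrite eqEcard TS T3.
    by move: (h3); rewrite ST T3 => /(_ erefl B BQ); rewrite sub.
  - rewrite /LQ_type3 => /andP[/eqP T4 _]; 
    by move: (leq_trans (subset_leq_card TS) c3); rewrite T4.
have nt T : T \subset S -> ~~ LQ_circ Q T.
  by move=> TS; apply: contra nd => cT; apply/existsP; exists T; rewrite TS.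
split.
- rewrite leqNgt; apply/negP => /card_subset_ex[T [TS T4]].
  have /negP[] := nt T TS; apply/or3P/Or33; rewrite /LQ_type3 T4 eqxx /=.
  apply/forallP => U; apply/implyP => UT.
  have := nt U (subset_trans UT TS); rewrite /LQ_circ !negb_or.
  by case/and3P=> -> ->.
- move=> p q B1 B2 pS qS pq B1Q B2Q B12 [p1 p2 q1 q2].
  have /nt/negP[] : [set p; q] \subset S by rewrite subUset !sub1set pS.
  apply/or3P/Or31; rewrite /LQ_type1 cards2 pq /=.
  apply/exists_inP; exists B1 => //; apply/exists_inP; exists B2 => //.
  by rewrite B12 subUset !sub1set !inE p1 p2 q1 q2.
- move=> S3 B BQ; apply/negP => SB; have /negP[] := nt S (subxx _).
  apply/or3P/Or32; rewrite /LQ_type2 S3 eqxx /=; apply/andP; split.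
    by apply/exists_inP; exists B.
  apply/forallP => U; apply/implyP => US.
  by have := nt U US; rewrite /LQ_circ !negb_or => /and3P[].
Qed.

End Blocks.

(** * Parametrization of configurations by block equations *)

Section Parametrization.
Variables (C : numFieldType) (n : nat).
Implicit Types (Q : {set {set 'I_n}}) (p q : Pt n) (S T : {set Pt n}).

(** Equations are indexed by all sets of lines, so one affine parameter space serves every
    partition. *)
Record param := Param {
  par_lam : {set 'I_n} -> 'rV[C]_3;
  par_t : Pt n -> C;
  par_u : Pt n -> 'rV[C]_3 }.

(* [par_lam x B] is the equation of the plane carrying the block [B]; a point
   on two blocks is a multiple of a cross product of equations, and a point
   inside [B] is an arbitrary vector of the plane, written as a cross product. *)
Definition phiv Q x p : 'rV[C]_3 :=
  if blk1 Q p == blk2 Q p then cross (par_lam x (blk1 Q p)) (par_u x p)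
  else par_t x p *: cross (par_lam x (blk1 Q p)) (par_lam x (blk2 Q p)).

Definition phi Q x : point C (Pt n * 'I_3)%type := fun pk => phiv Q x pk.1 0 pk.2.

Lemma vec_phi Q x p : vec (phi Q x) p = phiv Q x p.
Proof. by apply/rowP => j; rewrite mxE. Qed.

Lemma eq_phi Q x g : (forall p, vec g p = phiv Q x p) -> g = phi Q x.
Proof.
by move=> h; apply/funext => -[p k]; rewrite /phi /= -h mxE.
Qed.

Definition seg x y s := Param
  (fun B => par_lam x B + s *: (par_lam y B - par_lam x B))
  (fun p => par_t x p + s * (par_t y p - par_t x p))
  (fun p => par_u x p + s *: (par_u y p - par_u x p)).

Lemma seg0 x y : seg x y 0 = x.
Proof.
by case: x => l t u; congr Param; apply/funext => a; rewrite ?scale0r ?mul0r addr0.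
Qed.

Lemma seg1 x y : seg x y 1 = y.
Proof.
case: y => l t u; congr Param; apply/funext => a.
- by rewrite scale1r addrC subrK.
- by rewrite mul1r addrC subrK.
- by rewrite scale1r addrC subrK.
Qed.

Lemma curve_phi Q x y : curve (fun s => phi Q (seg x y s)).
Proof.
have FA := polyfun_algebra C.
have aff (a b : 'rV[C]_3) : vec_in (@polyfun C) (fun s => a + s *: (b - a)).
  apply: (vec_inD FA); first exact: (vec_in_const FA).
  apply: (vec_inZ FA (polyfun_id C)); exact: (vec_in_const FA).
move=> [p k]; rewrite /phi /= /phiv; case: (blk1 Q p == blk2 Q p).
  by apply: (vec_in_cross FA); apply: aff.
apply: (vec_inZ FA); last by apply: (vec_in_cross FA); apply: aff.
apply: (fun_algebraD FA); first exact: (fun_algebra_const FA).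
by apply: (fun_algebraM FA (polyfun_id C)); exact: (fun_algebra_const FA).
Qed.

Variable Q : {set {set 'I_n}}.
Hypothesis hQ : partition Q [set: 'I_n].

Lemma phiv_Hb x p B : B \in Q -> p \in Hb B -> dot (par_lam x B) (phiv Q x p) = 0.
Proof.
move=> BQ; rewrite (mem_Hb hQ) // /phiv => pB.
case: (blk1 Q p =P blk2 Q p) pB => [<-|_]; first by rewrite orbb => /eqP->; apply: dot_cross_l.
by rewrite dotZr => /orP[]/eqP->; rewrite ?dot_cross_l ?dot_cross_r mulr0.
Qed.

Lemma phiv_lam0 x p B : B \in Q -> p \in Hb B -> par_lam x B = 0 -> phiv Q x p = 0.
Proof.
move=> BQ pB l0; move: pB; rewrite (mem_Hb hQ) // /phiv.
case: (blk1 Q p =P blk2 Q p) => [<-|_]; first by rewrite orbb => /eqP->; rewrite l0 cross0l.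
by move=> /orP[]/eqP->; rewrite l0 ?cross0l 1?crossC ?cross0l ?oppr0 scaler0.
Qed.

Lemma phiv_inter x p B1 B2 : B1 \in Q -> B2 \in Q -> B1 != B2 ->
  p \in Hb B1 -> p \in Hb B2 ->
  exists k, phiv Q x p = k *: cross (par_lam x B1) (par_lam x B2).
Proof.
move=> B1Q B2Q /negbTE B12; rewrite !(mem_Hb hQ) // /phiv.
move=> /orP[]/eqP-> ; rewrite ?B12 /=.
  move=> /eqP->; rewrite B12; by exists (par_t x p).
rewrite orbF => /eqP->; rewrite eq_sym B12; exists (- par_t x p).
by rewrite crossC scalerN scaleNr.
Qed.

(** No genericity enters: points common to two blocks are multiples of one cross product, points of
    one block satisfy one equation, and four vectors are always dependent. *)
Lemma phi_dependent x S : dependent (LQ_circ Q) S -> lin_dep (phi Q x) S.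
Proof.
case/existsP=> T /andP[TS cT]; apply: (lin_depS TS) => {TS}.
case/or3P: cT.
- rewrite /LQ_type1 => /andP[/cards2P[p [q [pq ET]]] /exists_inP[B1 B1Q]].
  case/exists_inP=> B2 B2Q /andP[B12]; rewrite ET subUset !sub1set !inE.
  case/andP=> /andP[p1 p2] /andP[q1 q2]; apply: lin_dep_pair => //.
  rewrite !vec_phi; have [k ->] := phiv_inter x B1Q B2Q B12 p1 p2.
  have [l ->] := phiv_inter x B1Q B2Q B12 q1 q2.
  by rewrite crossZl crossZr cross_self !scaler0.
- rewrite /LQ_type2 => /andP[/andP[/eqP T3 /exists_inP[B BQ /subsetP sub]] _].
  (* A zero equation sends every point of the block to zero, so any plane will do. *)
  have [l0|l0] := eqVneq (par_lam x B) 0.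
    apply: (@lin_dep_plane _ _ _ _ (delta_mx 0 0)); rewrite ?T3 //.
      by apply/eqP => /rowP/(_ 0); rewrite !mxE !eqxx => /eqP; rewrite oner_eq0.
    by move=> p /sub pB; rewrite vec_phi (phiv_lam0 BQ pB l0) dotE !mxE !mulr0 !addr0.
  apply: (lin_dep_plane l0); rewrite ?T3 // => p /sub pB.
  by rewrite vec_phi phiv_Hb.
- rewrite /LQ_type3 => /andP[/eqP T4 _]; by apply: lin_dep_card; rewrite T4.
Qed.

End Parametrization.

(** * Existence and density of realizations *)

Lemma expn_cross_neq (x y l m : nat) : (0 < x)%N -> (0 < y)%N -> x != y -> l != m ->
  (x ^ l * y ^ m != x ^ m * y ^ l)%N.
Proof.
move=> x0 y0 xy; wlog lm : l m / (l < m)%N => [hw|_].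
  move=> lm; have := lm; rewrite neq_ltn => /orP[/hw/(_ lm)//|/hw h].
  by rewrite eq_sym h // eq_sym.
have e a b : (a ^ l * b ^ m = a ^ l * b ^ l * b ^ (m - l))%N.
  by rewrite -mulnA -expnD subnKC // ltnW.
rewrite e [(x ^ m * _)%N]mulnC e [(y ^ l * _)%N]mulnC eqn_pmul2l; last first.
  by rewrite muln_gt0 !expn_gt0 x0 y0.
by rewrite eqn_exp2r ?subn_gt0 // eq_sym.
Qed.

Section Realizability.
Variables (C : numFieldType) (n : nat) (Q : {set {set 'I_n}}).
Hypothesis hQ : partition Q [set: 'I_n].
Implicit Types (p q : Pt n) (S T : {set Pt n}) (B : {set 'I_n}).

Lemma position_ex S : (#|S| <= 3)%N ->
  exists pos : Pt n -> 'I_3, {in S &, injective pos}.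
Proof.
move=> c3; pose pos p : 'I_3 := inord (index p (enum S)); exists pos.
have posE r : r \in S -> nat_of_ord (pos r) = index r (enum S).
  move=> rS; rewrite /pos inordK //; apply: leq_trans c3.
  by rewrite cardE index_mem mem_enum.
have nthS p r : r \in S -> nth p (enum S) (index r (enum S)) = r.
  by move=> rS; rewrite nth_index ?mem_enum.
move=> p q pS qS e; rewrite -(nthS p q qS) -(posE q qS) -e (posE p pS).
exact/esym/nthS.
Qed.

Section Witness.
Variable S : {set Pt n}.
Hypothesis indS : ~~ dependent (LQ_circ Q) S.
Variable pos : Pt n -> 'I_3.
Hypothesis pos_inj : {in S &, injective pos}.

(** The point at position [m] is to become a multiple of the basis vector of index [m]; if it lies
    on [B], the equation of [B] must vanish at that coordinate. *)
Definition hit B m := [exists p in S, (pos p == m) && (p \in Hb B)].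

(** Otherwise [S] would be a triple inside [Hb B]. *)
Lemma not_all_hit B : B \in Q -> exists m, ~~ hit B m.
Proof.
move=> BQ; apply/existsP; rewrite -negb_forall; apply/negP => /forallP all_hit.
have [_ _ h3] := (LQ_independentP Q S).1 indS.
have [c3 _ _] := (LQ_independentP Q S).1 indS.
have S3 : #|S| = 3.
  apply/eqP; rewrite eqn_leq c3 /= -(card_in_imset pos_inj) -[X in (X <= _)%N]card_ord.
  rewrite -cardsT; apply: subset_leq_card; apply/subsetP => m _.
  have /exists_inP[p pS /andP[/eqP<- _]] := all_hit m.
  exact: imset_f.
have /negP[] := h3 S3 B BQ; apply/subsetP => p pS.
have /exists_inP[q qS /andP[/eqP/pos_inj->]] := all_hit (pos p); by [].
Qed.

(** Two common coordinates would come from a Type 1 pair inside [S]. *)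
Lemma hit_inter B1 B2 k m : B1 \in Q -> B2 \in Q -> B1 != B2 ->
  hit B1 k -> hit B2 k -> hit B1 m -> hit B2 m -> k = m.
Proof.
move=> B1Q B2Q B12 /exists_inP[p pS /andP[/eqP<- p1]].
case/exists_inP=> p' p'S /andP[/eqP/pos_inj->// p2] .
case/exists_inP=> q qS /andP[/eqP<- q1].
case/exists_inP=> q' q'S /andP[/eqP/pos_inj->// q2].
have [_ h2 _] := (LQ_independentP Q S).1 indS.
by have [->//|pq] := eqVneq p q; case: (h2 p q B1 B2).
Qed.

(** Zeros where they are forced; elsewhere powers of an integer specific to [B], which keeps the
    needed minors of two equations nonzero. *)
Definition lam B : 'rV[C]_3 :=
  \row_m if hit B m then 0 else ((enum_rank B).+1 ^ m)%:R.

Lemma lam_neq0 B : B \in Q -> lam B != 0.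
Proof.
move=> /not_all_hit[m hm]; apply/eqP => /rowP/(_ m); rewrite !mxE (negbTE hm).
by move/eqP; rewrite pnatr_eq0 expn_eq0.
Qed.

(** Both equations vanish at [k], so the product lies along one basis vector and its coefficient is
    a 2x2 minor. Each equation has at most one other forced zero, never at the same place, so the
    minor is a single nonzero product or a Vandermonde-like difference of powers. *)
Lemma cross_lam B1 B2 k : B1 \in Q -> B2 \in Q -> B1 != B2 ->
  hit B1 k -> hit B2 k ->
  exists2 c, c != 0 & cross (lam B1) (lam B2) = c *: delta_mx 0 k.
Proof.
move=> B1Q B2Q B12 h1 h2.
have e1 : lam B1 0 k = 0 by rewrite mxE h1.
have e2 : lam B2 0 k = 0 by rewrite mxE h2.
rewrite (cross_delta e1 e2); set c := (X in X *: _); exists c => // {e1 e2}.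
have kl : k != k + 1 by rewrite -subr_eq0 opprD addNKr.
have km : k != k + 2%:R by rewrite -subr_eq0 opprD addNKr.
have lm : k + 1 != k + 2%:R by rewrite (inj_eq (addrI k)).
rewrite /c !mxE; move: (k + 1) (k + 2%:R) kl km lm => l m kl km lm.
have no1 : ~~ (hit B1 l && hit B1 m).
  apply/negP => /andP[hl hm]; have [j /negP] := not_all_hit B1Q; case.
  have /orP[/eqP->|/orP[]/eqP->//] : [|| j == k, j == l | j == m]; last by [].
  move: kl km lm; clear.
  by case: (ord3P k) => ->; case: (ord3P l) => ->; case: (ord3P m) => ->;
     case: (ord3P j) => ->.
have no2 : ~~ (hit B2 l && hit B2 m).
  apply/negP => /andP[hl hm]; have [j /negP] := not_all_hit B2Q; case.
  have /orP[/eqP->|/orP[]/eqP->//] : [|| j == k, j == l | j == m]; last by [].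
  move: kl km lm; clear.
  by case: (ord3P k) => ->; case: (ord3P l) => ->; case: (ord3P m) => ->;
     case: (ord3P j) => ->.
have nol : ~~ (hit B1 l && hit B2 l).
  apply/negP => /andP[hl hl']; case/eqP: kl.
  exact: (@hit_inter B1 B2).
have nom : ~~ (hit B1 m && hit B2 m).
  apply/negP => /andP[hm hm']; case/eqP: km.
  exact: (@hit_inter B1 B2).
move: no1 no2 nol nom.
have nz B k' : ((enum_rank B).+1 ^ nat_of_ord k')%:R != 0 :> C.
  by rewrite pnatr_eq0 expn_eq0.
case: (hit B1 l); case: (hit B1 m); case: (hit B2 l); case: (hit B2 m) => // _ _ _ _;
  rewrite ?(mul0r, mulr0, sub0r, subr0) ?oppr_eq0 ?mulf_neq0 //.
rewrite subr_eq0 -!natrM eqr_nat expn_cross_neq //.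
by rewrite eqSS; apply: contra B12 => /eqP/val_inj/enum_rank_inj->.
Qed.

(** Each point of [S] goes to a nonzero multiple of its own basis vector: by solving for [u] inside
    a block, by [cross_lam] on two blocks. *)
Lemma independent_phi_pos : exists x : param C n, ~ lin_dep (phi Q x) S.
Proof.
have hitp p B : p \in S -> p \in Hb B -> hit B (pos p).
  by move=> pS pB; apply/exists_inP; exists p; rewrite ?eqxx.
have [u hu] : exists u : Pt n -> 'rV[C]_3, forall p, p \in S ->
    blk1 Q p = blk2 Q p -> cross (lam (blk1 Q p)) (u p) = delta_mx 0 (pos p).
  apply: (@fin_all_exists _ _ (fun p v => p \in S -> blk1 Q p = blk2 Q p ->
    cross (lam (blk1 Q p)) v = delta_mx 0 (pos p))) => p.
  have [pS|] := boolP (p \in S); last by exists 0.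
  have bQ : blk1 Q p \in Q by apply: pblock_in.
  have [|v hv] := dot_solve (lam_neq0 bQ) (w := delta_mx 0 (pos p)).
    by rewrite dot_delta mxE hitp ?(mem_Hb hQ) ?eqxx.
  by exists v.
exists (Param lam (fun=> 1) u) => -[c [[p [pS cp]] sum0]].
have hp q : q \in S -> exists2 d, d != 0 &
    phiv Q (Param lam (fun=> 1) u) q = d *: delta_mx 0 (pos q).
  move=> qS; rewrite /phiv /=; have [e|ne] := eqVneq (blk1 Q q) (blk2 Q q).
    by exists 1; rewrite ?oner_eq0 // scale1r hu.
  rewrite scale1r; apply: cross_lam; rewrite ?pblock_in //.
    by apply: hitp; rewrite ?(mem_Hb hQ) ?pblock_in ?eqxx.
  by apply: hitp; rewrite ?(mem_Hb hQ) ?pblock_in ?eqxx ?orbT.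
move/rowP/(_ (pos p)): sum0; rewrite summxE mxE (bigD1 p) //= big1 => [|q].
  rewrite addr0 vec_phi mxE; have [d d0 ->] := hp p pS.
  by rewrite !mxE !eqxx mulr1 => /eqP; rewrite mulf_eq0 (negbTE cp) (negbTE d0).
case/andP=> qS qp; rewrite mxE vec_phi; have [d d0 ->] := hp q qS.
rewrite !mxE eqxx /=; case: eqP => [/(pos_inj pS qS)/eqP|]; last by rewrite !mulr0.
by rewrite eq_sym (negbTE qp).
Qed.

End Witness.

Lemma independent_phi S : ~~ dependent (LQ_circ Q) S ->
  exists x : param C n, ~ lin_dep (phi Q x) S.
Proof.
move=> indS; have [/position_ex[pos pos_inj] _ _] := (LQ_independentP Q S).1 indS.
exact: independent_phi_pos pos_inj.
Qed.

(** Dependences hold for all parameters, and each of the finitely many required independences is an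
    open condition on the segment. *)
Lemma almost_all_realization x y :
  (forall S, ~~ dependent (LQ_circ Q) S ->
     exists s, ~ lin_dep (phi Q (seg x y s)) S) ->
  for_almost_all (fun s : C => realization (LQ_circ Q) (phi Q (seg x y s))).
Proof.
move=> h; have : for_almost_all (fun s : C => forall S,
    ~~ dependent (LQ_circ Q) S -> ~ lin_dep (phi Q (seg x y s)) S).
  apply: almost_all_fin => S; have [dS|ndS] := boolP (dependent (LQ_circ Q) S).
    by exists 1; rewrite ?oner_eq0.
  have [s0 hs0] := h S ndS.
  by apply: almost_all_mono (almost_all_lin_indep (curve_phi Q x y) hs0).
apply: almost_all_mono => s hs S; split=> [ld|]; last exact: phi_dependent.
by apply: contrapT => /negP/hs.
Qed.

Lemma realizable : exists x : param C n, realization (LQ_circ Q) (phi Q x).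
Proof.
suff [x hx] : exists x : param C n, forall S, S \in enum [set: {set Pt n}] ->
    ~~ dependent (LQ_circ Q) S -> ~ lin_dep (phi Q x) S.
  exists x => S; split=> [ld|]; last exact: phi_dependent.
  by apply: contrapT => /negP nd; apply: (hx S) ld => //; rewrite mem_enum inE.
(* Subsets are treated one at a time: a general parameter between [x], good for the earlier ones,
   and [y], good for [S], is good for all. *)
elim: (enum _) => [|S r [x hx]].
  by exists (Param (fun=> 0) (fun=> 0) (fun=> 0)).
have [dS|ndS] := boolP (dependent (LQ_circ Q) S).
  by exists x => T; rewrite inE => /orP[/eqP->|/hx//]; rewrite dS.
have [y hy] := independent_phi ndS.
have h1 : for_almost_all (fun s : C => ~ lin_dep (phi Q (seg x y s)) S).
  by apply: (almost_all_lin_indep (curve_phi Q x y) (s0 := 1)); rewrite seg1.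
have h2 : for_almost_all (fun s : C => forall T, T \in r ->
    ~~ dependent (LQ_circ Q) T -> ~ lin_dep (phi Q (seg x y s)) T).
  apply: almost_all_seq => T Tr; have [dT|ndT] := boolP (dependent (LQ_circ Q) T).
    by exists 1; rewrite ?oner_eq0.
  have : for_almost_all (fun s : C => ~ lin_dep (phi Q (seg x y s)) T).
    apply: (almost_all_lin_indep (curve_phi Q x y) (s0 := 0)).
    by rewrite seg0; apply: hx.
  exact: almost_all_mono.
have /almost_all_ex[s [hs1 hs2]] := almost_all_and h1 h2.
by exists (seg x y s) => T; rewrite inE => /orP[/eqP->|/hs2].
Qed.

(** Every parameter is joined by a segment to a realizing one, and almost all parameters of that
    segment realize, so it suffices to treat realizations. *)
Lemma zclosure_phi A :
  (forall x : param C n, realization (LQ_circ Q) (phi Q x) -> zclosure A (phi Q x)) ->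
  forall x, zclosure A (phi Q x).
Proof.
move=> h x; have [y hy] := realizable; rewrite -(seg0 x y).
apply: (zclosure_curve (curve_phi Q x y)).
apply: (almost_all_mono (fun s => h (seg x y s))).
apply: almost_all_realization => S ndS; exists 1; rewrite seg1 => /hy.
by apply/negP.
Qed.

Lemma phi_matroid_variety (x : param C n) : matroid_variety (LQ_circ Q) (phi Q x).
Proof. by apply: zclosure_phi x => x; apply: zclosureW. Qed.

End Realizability.

(** * From the circuit variety of [L_n] to parametrized configurations *)

Section CircuitVariety.
Variables (C : numFieldType) (n : nat).
Implicit Types (Q : {set {set 'I_n}}) (p q : Pt n) (S T : {set Pt n}).
Implicit Types (g : point C (Pt n * 'I_3)%type).

Lemma dependentS (circ : circuits n) S T :
  S \subset T -> dependent circ S -> dependent circ T.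
Proof.
move=> ST /existsP[U /andP[US cU]]; apply/existsP; exists U.
by rewrite (subset_trans US ST).
Qed.

Lemma circ_dependent (circ : circuits n) S : circ S -> dependent circ S.
Proof. by move=> cS; apply/existsP; exists S; rewrite subxx. Qed.

Lemma dependent_Hb Q B T : B \in Q -> #|T| = 3 -> T \subset Hb B ->
  dependent (LQ_circ Q) T.
Proof.
move=> BQ T3 TB; apply: contraT => /(LQ_independentP Q T).1[_ _ /(_ T3 B BQ)].
by rewrite TB.
Qed.

Lemma line_sub_Hb (B : {set 'I_n}) i : i \in B -> line i \subset Hb B.
Proof. by move=> iB; apply: bigcup_sup. Qed.

Lemma Ln_dependent_LQ Q S : partition Q [set: 'I_n] ->
  dependent (@Ln_circ n) S -> dependent (LQ_circ Q) S.
Proof.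
move=> hQ /existsP[T /andP[TS cT]]; apply: dependentS TS _.
case/orP: cT => /andP[/eqP cT].
  case/existsP=> i Ti; apply: (dependent_Hb (pblock_in hQ i)) => //.
  by apply: subset_trans Ti (line_sub_Hb _); apply: mem_pblock_self.
by move=> _; apply: contraT => /(LQ_independentP Q T).1[]; rewrite cT.
Qed.

Lemma matroid_variety_lin_dep (circ : circuits n) g S :
  matroid_variety circ g -> dependent circ S -> lin_dep g S.
Proof.
move=> Vg dS; apply: (zclosureS (zclosed_lin_dep C S) _ Vg) => w /(_ S)[_].
exact.
Qed.

Lemma matroid_variety_circuit_variety Q g : partition Q [set: 'I_n] ->
  matroid_variety (LQ_circ Q) g -> circuit_variety (@Ln_circ n) g.
Proof.
by move=> hQ Vg S /(Ln_dependent_LQ hQ); apply: matroid_variety_lin_dep.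
Qed.

Lemma circuit_variety_lines g : circuit_variety (@Ln_circ n) g ->
  exists lam : 'I_n -> 'rV[C]_3, forall i,
    lam i != 0 /\ forall p, i \in val p -> dot (lam i) (vec g p) = 0.
Proof.
move=> cg; apply: (@fin_all_exists _ _ (fun i l =>
  l != 0 /\ forall p : Pt n, i \in val p -> dot l (vec g p) = 0)) => i.
have [T Ti T3|l l0 hl] := @plane_of_lin_dep _ _ g (line i).
  apply/cg/circ_dependent/orP; left; rewrite T3 eqxx /=.
  by apply/existsP; exists i.
by exists l; split=> // p ip; apply: hl; rewrite inE.
Qed.

Lemma label_partition (c : 'I_n -> {set 'I_n}) :
  (forall i, i \in c i) -> (forall i j, j \in c i -> c j = c i) ->
  partition [set c i | i : 'I_n] [set: 'I_n] /\
  forall i, pblock [set c i | i : 'I_n] i = c i.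
Proof.
move=> cii cij.
have tI : trivIset [set c i | i : 'I_n].
  apply/trivIsetP => _ _ /imsetP[i _ ->] /imsetP[j _ ->] ne.
  apply/pred0P => k /=; apply/negP => /andP[/cij ki /cij kj].
  by case/eqP: ne; rewrite -ki -kj.
split; last by move=> i; apply: def_pblock => //; apply: imset_f.
apply/and3P; split=> //.
  rewrite eqEsubset subsetT /=; apply/subsetP => i _.
  by apply/bigcupP; exists (c i); rewrite ?imset_f.
by apply/imsetP => -[i _ e]; have := cii i; rewrite -e inE.
Qed.

(** An arbitrary element of [B] supplies the common value for the block; [x0] covers the empty
    set. *)
Definition pick_in (T : Type) (x0 : T) (f : 'I_n -> T) (B : {set 'I_n}) : T :=
  if [pick i in B] is Some i then f i else x0.

Lemma pick_inP (T : Type) (x0 : T) f (B : {set 'I_n}) i : i \in B ->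
  exists2 j, j \in B & pick_in x0 f B = f j.
Proof.
by rewrite /pick_in; case: pickP => [j jB _|-> //]; exists j.
Qed.

Lemma circuit_variety_phi g : circuit_variety (@Ln_circ n) g ->
  exists Q (x : param C n), partition Q [set: 'I_n] /\ g = phi Q x.
Proof.
case/circuit_variety_lines=> lam hlam.
have lam0 i : lam i != 0 by case: (hlam i).
have lamg i p : i \in val p -> dot (lam i) (vec g p) = 0.
  by case: (hlam i) => _; apply.
(* The lines whose equations are proportional to that of [i]. *)
pose c i := [set j | cross (lam i) (lam j) == 0].
have cP i j : reflect (exists k, lam j = k *: lam i) (j \in c i).
  rewrite inE; apply: (iffP eqP) => [|[k ->]]; last first.
    by rewrite crossZr cross_self scaler0.
  by rewrite crossC => /eqP; rewrite oppr_eq0 => /eqP; apply: cross_eq0.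
have cii i : i \in c i by rewrite inE cross_self.
have cij i j : j \in c i -> c j = c i.
  case/cP=> k lj; have k0 : k != 0.
    by apply: contraNneq (lam0 j) => k0; rewrite lj k0 scale0r.
  by apply/setP => l; rewrite !inE lj crossZl scaler_eq0 (negbTE k0).
have [hQ pblockE] := label_partition cii cij.
set Q := [set c i | i : 'I_n] in hQ pblockE.
pose mu := pick_in 0 lam.
have muP i : exists2 j, mu (pblock Q i) = lam j & c j = c i.
  by rewrite pblockE /mu; have [j /cij ? ->] := pick_inP 0 lam (cii i); exists j.
have mug i p : i \in val p -> dot (mu (pblock Q i)) (vec g p) = 0.
  move=> ip; have [j -> cji] := muP i.
  have /cP[k ->] : j \in c i by rewrite -cji.
  by rewrite dotZl lamg ?mulr0.
have end1_in p : end1 p \in val p by rewrite mem_ends eqxx.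
have end2_in p : end2 p \in val p by rewrite mem_ends eqxx orbT.
have [u hu] : exists u : Pt n -> 'rV[C]_3, forall p,
    cross (mu (blk1 Q p)) (u p) = vec g p.
  apply: (@fin_all_exists _ _ (fun p v => cross (mu (blk1 Q p)) v = vec g p)) => p.
  by apply: dot_solve; [case: (muP (end1 p)) => j -> _|apply: mug].
(* Equations from different classes are not proportional, so their cross product is nonzero and
   spans the vectors orthogonal to both. *)
have [t ht] : exists t : Pt n -> C, forall p, blk1 Q p != blk2 Q p ->
    vec g p = t p *: cross (mu (blk1 Q p)) (mu (blk2 Q p)).
  apply: (@fin_all_exists _ _ (fun p k => blk1 Q p != blk2 Q p ->
    vec g p = k *: cross (mu (blk1 Q p)) (mu (blk2 Q p)))) => p.
  have [e|ne] := eqVneq (blk1 Q p) (blk2 Q p); first by exists 0.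
  have [|k hk] := @ortho_cross _ (mu (blk1 Q p)) (mu (blk2 Q p)) (vec g p) _
    (mug _ _ (end1_in p)) (mug _ _ (end2_in p)); last by exists k.
  move: ne; rewrite /blk1 /blk2 !pblockE.
  have := muP (end1 p); have := muP (end2 p); rewrite !pblockE.
  move=> [j -> <-] [i -> <-]; apply: contraNneq => e.
  by apply/eqP/esym/cij; rewrite inE e.
exists Q, (Param mu t u); split=> //; apply: eq_phi => p.
rewrite /phiv /=; case: eqP => [_|/eqP ne]; first by rewrite hu.
exact: ht.
Qed.

End CircuitVariety.

(** * Removing blocks of size [n - 1], 2 and 3 *)

Section AdmissibleRefinement.
Variables (C : numFieldType) (n : nat).
Hypothesis n4 : (4 <= n)%N.
Implicit Types (Q : {set {set 'I_n}}) (p q : Pt n) (S T : {set Pt n}).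
Implicit Types (x : param C n).

Lemma partition_setT : partition [set [set: 'I_n]] [set: 'I_n] /\
  forall i, pblock [set [set: 'I_n]] i = [set: 'I_n].
Proof.
have tI : trivIset [set [set: 'I_n]].
  by apply/trivIsetP => A B; rewrite !inE => /eqP-> /eqP->; rewrite eqxx.
split; last by move=> i; apply: def_pblock; rewrite ?inE.
rewrite /partition tI /cover big_set1 eqxx inE eq_sym -card_gt0 cardsT card_ord.
exact: leq_trans n4.
Qed.

(** Only one line is outside [B] while a point needs two, so every vector satisfies the equation
    [par_lam x B]. *)
Lemma phi_merge Q x B : partition Q [set: 'I_n] -> B \in Q -> #|B| = n.-1 ->
  matroid_variety (LQ_circ [set [set: 'I_n]]) (phi Q x).
Proof.
move=> hQ BQ Bn; have [hT pT] := partition_setT.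
have inB p : (blk1 Q p == B) || (blk2 Q p == B).
  rewrite /blk1 /blk2 -!(mem_block hQ) //.
  apply: contraT; rewrite negb_or => /andP[e1 e2].
  have : (#|[set end1 p; end2 p] :|: B| <= n)%N.
    by rewrite -[X in (_ <= X)%N]card_ord max_card.
  rewrite cardsU (_ : _ :&: _ = set0) ?cards0 ?subn0 ?cards2 ?end_neq ?Bn.
    by rewrite -ltnS; case: (n) n4 => // m _; rewrite /= ltnS ltnn.
  apply/setP => i; rewrite !inE; apply/negP => /andP[/orP[]/eqP-> iB].
    by rewrite iB in e1.
  by rewrite iB in e2.
(* This [u] rewrites each vector as a cross product with [par_lam x B] on the left; the minus sign
   occurs when [B] is the second factor. *)
pose u p := if blk1 Q p == blk2 Q p then par_u x p else
  if blk1 Q p == B then par_t x p *: par_lam x (blk2 Q p)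
  else - (par_t x p *: par_lam x (blk1 Q p)).
pose y := Param (fun=> par_lam x B) (fun=> 0) u.
rewrite (_ : phi Q x = phi [set [set: 'I_n]] y).
  exact: phi_matroid_variety hT y.
apply: eq_phi => p; rewrite vec_phi /phiv /blk1 /blk2 !pT eqxx /=.
rewrite -/(blk1 Q p) -/(blk2 Q p) /u; have := inB p.
have [<-|ne] := eqVneq (blk1 Q p) (blk2 Q p); first by rewrite orbb => /eqP->.
have [->|_] := eqVneq (blk1 Q p) B; first by rewrite crossZr.
by move=> /= /eqP->; rewrite crossNr crossZr crossC scalerN.
Qed.

(** Both lines through [p] are in [B], so [p] lies on no other block and in no Type 1 pair. *)
Lemma independent_pair Q p q B : partition Q [set: 'I_n] ->
  blk1 Q p = B -> blk2 Q p = B -> p != q ->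
  ~~ dependent (LQ_circ Q) [set p; q].
Proof.
move=> hQ p1 p2 pq; apply/(LQ_independentP Q _).2; rewrite cards2 pq; split=> //.
have pB B1 : B1 \in Q -> p \in Hb B1 -> B1 = B.
  by move=> B1Q; rewrite (mem_Hb hQ) // p1 p2 orbb => /eqP.
move=> r r' B1 B2; rewrite !inE => /orP[]/eqP-> /orP[]/eqP->; rewrite ?eqxx //.
- by move=> _ B1Q B2Q /eqP B12 [/(pB _ B1Q) e1 /(pB _ B2Q) e2 _ _]; rewrite e1 e2 in B12.
- by move=> _ B1Q B2Q /eqP B12 [_ _ /(pB _ B1Q) e1 /(pB _ B2Q) e2]; rewrite e1 e2 in B12.
Qed.

Lemma det_in_block Q x p q B : partition Q [set: 'I_n] ->
  realization (LQ_circ Q) (phi Q x) ->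
  blk1 Q p = B -> blk2 Q p = B -> blk1 Q q = B -> blk2 Q q = B -> p != q ->
  dot (par_lam x B) (cross (par_u x p) (par_u x q)) != 0.
Proof.
move=> hQ rx p1 p2 q1 q2 pq; apply/eqP => d0.
have /negP[] := independent_pair hQ p1 p2 pq.
apply/(rx _)/lin_dep_pair => //; rewrite !vec_phi /phiv p1 p2 q1 q2 eqxx.
by rewrite cross_cross_pivot d0 scale0r.
Qed.

Lemma val_sub_ends p (B : {set 'I_n}) :
  (val p \subset B) = (end1 p \in B) && (end2 p \in B).
Proof. by rewrite val_ends subUset !sub1set. Qed.

(* Moving the equation of line [i] by [s *: v i] separates the lines of a small
   block while keeping its points in place to first order. *)
Lemma block_offsets Q x B : partition Q [set: 'I_n] ->
  realization (LQ_circ Q) (phi Q x) -> B \in Q -> (#|B| <= 3)%N ->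
  exists v : 'I_n -> 'rV[C]_3, forall p, val p \subset B ->
    exists2 a, a != 0 & cross (par_lam x B) (v (end2 p) - v (end1 p)) =
                        a *: cross (par_lam x B) (par_u x p).
Proof.
move=> hQ rx BQ; set l := par_lam x B.
have blkB p : val p \subset B -> blk1 Q p = B /\ blk2 Q p = B.
  by rewrite val_sub_ends !(mem_block hQ) // => /andP[/eqP ? /eqP ?].
(* Exchanging the ends only changes the sign of [a], so either orientation of the pair may be
   used. *)
have orient (v : 'I_n -> 'rV[C]_3) p i j : val p = [set i; j] ->
    (exists2 a, a != 0 & cross l (v j - v i) = a *: cross l (par_u x p)) ->
    exists2 a, a != 0 & cross l (v (end2 p) - v (end1 p)) = a *: cross l (par_u x p).
  move=> /ends_set2[[-> ->]//|[-> ->]] [a a0 e]; exists (- a).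
    by rewrite oppr_eq0.
  by rewrite -opprB crossNr e scaleNr.
rewrite leq_eqVlt => /orP[/eqP B3|].
  have /card_gt0P[i iB] : (0 < #|B|)%N by rewrite B3.
  have /eqP/cards2P[j [k [jk EB]]] : #|B :\ i| = 2.
    by have := cardsD1 i B; rewrite iB B3 => -[].
  have ij : i != j by have := set21 j k; rewrite -EB !inE eq_sym => /andP[].
  have ik : i != k by have := set22 j k; rewrite -EB !inE eq_sym => /andP[].
  have BE : B = [set i; j; k] by rewrite -(setD1K iB) EB setUA.
  have [p pE] := Pt_ex ij; have [q qE] := Pt_ex jk; have [r rE] := Pt_ex ik.
  have [p1 p2] : blk1 Q p = B /\ blk2 Q p = B.
    by apply: blkB; rewrite pE BE subsetUl.
  have [q1 q2] : blk1 Q q = B /\ blk2 Q q = B.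
    by apply: blkB; rewrite qE -EB subsetDl.
  have [r1 r2] : blk1 Q r = B /\ blk2 Q r = B.
    by apply: blkB; rewrite rE BE subUset !sub1set !inE !eqxx !orbT.
  have neq (p' q' : Pt n) m : m \in val p' -> m \notin val q' -> p' != q'.
    by move=> h; apply: contraNneq => <-.
  have pq : p != q by apply: (neq _ _ i); rewrite ?pE ?qE !inE ?eqxx // negb_or ij.
  have qr : q != r.
    by apply: (neq _ _ j); rewrite ?rE ?qE !inE ?eqxx // negb_or eq_sym ij.
  have rp : r != p.
    by apply: (neq _ _ k); rewrite ?rE ?pE !inE ?eqxx ?orbT // negb_or ![k == _]eq_sym ik jk.
  (* Offsets are sought with differences parallel to the three [par_u] modulo [l]. Cramer's relation
     closes this triangle: the steps [al *: par_u x p] and [be *: par_u x q] add up to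
     [- ga *: par_u x r] modulo [l]. *)
  pose al := dot l (cross (par_u x q) (par_u x r)).
  pose be := dot l (cross (par_u x r) (par_u x p)).
  pose ga := dot l (cross (par_u x p) (par_u x q)).
  have al0 : al != 0 := det_in_block hQ rx q1 q2 r1 r2 qr.
  have be0 : be != 0 := det_in_block hQ rx r1 r2 p1 p2 rp.
  have ga0 : ga != 0 := det_in_block hQ rx p1 p2 q1 q2 pq.
  have rel := cross_cramer l (par_u x p) (par_u x q) (par_u x r).
  rewrite -/al -/be -/ga crossDr [cross l (ga *: _)]crossZr in rel.
  pose v m := if m == i then 0 else if m == j then al *: par_u x p
              else al *: par_u x p + be *: par_u x q.
  exists v => p' p'B.
  have eqv (p1' p2' : Pt n) (D : {set 'I_n}) : val p1' = D -> val p2' = D -> p1' = p2'.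
    by move=> e1 e2; apply: val_inj; rewrite e1 e2.
  have : [\/ val p' = [set i; j], val p' = [set j; k] | val p' = [set i; k]].
    move: p'B (end_neq p'); rewrite val_sub_ends BE val_ends !inE -!orbA.
    case/andP=> /or3P[] /eqP-> /or3P[] /eqP->; rewrite ?eqxx // => _.
    - by constructor 1.
    - by constructor 3.
    - by constructor 1; rewrite setUC.
    - by constructor 2.
    - by constructor 3; rewrite setUC.
    - by constructor 2; rewrite setUC.
  case=> e; apply: (orient v _ _ _ e); rewrite /v.
  + rewrite (eqv _ _ _ e pE) eqxx [j == i]eq_sym (negbTE ij) eqxx subr0.
    by exists al; rewrite ?crossZr.
  + rewrite (eqv _ _ _ e qE) ![_ == i]eq_sym (negbTE ij) (negbTE ik) eqxx.
    rewrite eq_sym (negbTE jk) addrC addKr.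
    by exists be; rewrite ?crossZr.
  + rewrite (eqv _ _ _ e rE) eqxx [k == i]eq_sym (negbTE ik) [k == j]eq_sym (negbTE jk).
    exists (- ga); first by rewrite oppr_eq0.
    by rewrite subr0 scaleNr; apply/eqP; rewrite -addr_eq0 rel.
rewrite ltnS leq_eqVlt => /orP[/cards2P[i [j [ij BE]]]|B1].
  have [p pE] := Pt_ex ij.
  (* The block contains a single point, whose own direction serves as offset. *)
  pose v m := if m == j then par_u x p else 0; exists v => p' p'B.
  have p'E : val p' = [set i; j].
    apply/eqP; rewrite -BE eqEcard p'B BE cards2 ij.
    by rewrite (eqP (valP p')).
  have -> : p' = p by apply: val_inj; rewrite p'E pE.
  apply: (orient v _ _ _ pE); rewrite /v; exists 1; rewrite ?oner_eq0 //.
  by rewrite eqxx (negbTE ij) subr0 scale1r.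
exists (fun=> 0) => p /subset_leq_card; rewrite (eqP (valP p)) => le.
by move: (leq_trans le B1).
Qed.

(** * Splitting small blocks into singletons *)

Section Splitting.
Variable Q : {set {set 'I_n}}.
Hypothesis hQ : partition Q [set: 'I_n].

Definition split_label i :=
  if (#|pblock Q i| <= 3)%N then [set i] else pblock Q i.

Definition split_partition : {set {set 'I_n}} := [set split_label i | i : 'I_n].

Lemma split_label_self i : i \in split_label i.
Proof. by rewrite /split_label; case: ifP; rewrite ?inE // mem_pblock_self. Qed.

Lemma split_label_eq i j : j \in split_label i -> split_label j = split_label i.
Proof.
rewrite /split_label; case: ifP => Qi; first by rewrite inE => /eqP->; rewrite Qi.
by rewrite (mem_block hQ) ?pblock_in // => /eqP->; rewrite Qi.
Qed.

Lemma split_partitionP : partition split_partition [set: 'I_n].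
Proof. by case: (label_partition split_label_self split_label_eq). Qed.

Lemma pblock_split i : pblock split_partition i = split_label i.
Proof. by case: (label_partition split_label_self split_label_eq). Qed.

Lemma split_blocks p : (blk1 split_partition p == blk2 split_partition p) =
  (blk1 Q p == blk2 Q p) && (3 < #|blk1 Q p|)%N.
Proof.
have := end_neq p.
rewrite /blk1 /blk2 !pblock_split -[LHS]/(split_label _ == _) => ne.
apply/eqP/andP => [e|[/eqP e]]; last first.
  by rewrite ltnNge /split_label -e => /negbTE->.
have := split_label_self (end2 p); rewrite -e {1}/split_label.
case: ifP => Qi; first by rewrite inE eq_sym (negbTE ne).
by rewrite ltnNge Qi (mem_block hQ) ?pblock_in // eq_sym.
Qed.

(** A realization is the value at [s = 0] of a curve whose other points are parametrized by the
    split partition, so it lies in the closure. *)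
Lemma phi_split x : matroid_variety (LQ_circ split_partition) (phi Q x).
Proof.
apply: (zclosure_phi hQ) x => x rx.
have [V hV] : exists V : {set 'I_n} -> 'I_n -> 'rV[C]_3, forall B,
    B \in Q -> (#|B| <= 3)%N -> forall p, val p \subset B ->
    exists2 a, a != 0 & cross (par_lam x B) (V B (end2 p) - V B (end1 p)) =
                        a *: cross (par_lam x B) (par_u x p).
  apply: (@fin_all_exists _ _ (fun B v => B \in Q -> (#|B| <= 3)%N ->
    forall p, val p \subset B ->
    exists2 a, a != 0 & cross (par_lam x B) (v (end2 p) - v (end1 p)) =
                        a *: cross (par_lam x B) (par_u x p))) => B.
  have [BQ|] := boolP (B \in Q); last by exists (fun=> 0).
  have [B3|] := boolP (#|B| <= 3)%N; last by exists (fun=> 0).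
  by have [v hv] := block_offsets hQ rx BQ B3; exists v.
pose v i := if (#|pblock Q i| <= 3)%N then V (pblock Q i) i else 0.
have [a ha] : exists a : Pt n -> C, forall p, a p != 0 /\
    (blk1 Q p = blk2 Q p -> (#|blk1 Q p| <= 3)%N ->
     cross (par_lam x (blk1 Q p)) (v (end2 p) - v (end1 p)) =
     a p *: cross (par_lam x (blk1 Q p)) (par_u x p)).
  apply: (@fin_all_exists _ _ (fun p k => k != 0 /\
    (blk1 Q p = blk2 Q p -> (#|blk1 Q p| <= 3)%N ->
     cross (par_lam x (blk1 Q p)) (v (end2 p) - v (end1 p)) =
     k *: cross (par_lam x (blk1 Q p)) (par_u x p)))) => p.
  have [e|ne] := eqVneq (blk1 Q p) (blk2 Q p); last first.
    exists 1; split; first by rewrite oner_eq0.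
    by move=> e; rewrite e eqxx in ne.
  have [B3|nB3] := boolP (#|blk1 Q p| <= 3)%N; last first.
    by exists 1; split; first by rewrite oner_eq0.
  have bQ : blk1 Q p \in Q by apply: pblock_in.
  have [|k k0 hk] := hV _ bQ B3 p.
    by rewrite val_sub_ends !(mem_block hQ) // -/(blk2 Q p) -e !eqxx.
  exists k; split=> // _ _; rewrite /v -/(blk1 Q p) -/(blk2 Q p) -e B3.
  exact: hk.
pose lam s i := par_lam x (pblock Q i) + s *: v i.
(* For a point inside a small block this is the cross product of the two perturbed equations divided
   by [s * a p], by [cross_perturb]. In a large block [v] is zero and the point does not move. *)
pose gv s p := if blk1 Q p == blk2 Q p then
    cross (par_lam x (blk1 Q p)) (par_u x p) +
      s *: ((a p)^-1 *: cross (v (end1 p)) (v (end2 p)))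
  else par_t x p *: cross (lam s (end1 p)) (lam s (end2 p)).
pose g s : point C (Pt n * 'I_3)%type := fun pk => gv s pk.1 0 pk.2.
have cg : curve g.
  have FA := polyfun_algebra C.
  have aff (b c : 'rV[C]_3) : vec_in (@polyfun C) (fun s => b + s *: c).
    apply: (vec_inD FA); first exact: (vec_in_const FA).
    by apply: (vec_inZ FA (polyfun_id C)); exact: (vec_in_const FA).
  move=> [p k]; rewrite /g /= /gv; case: (blk1 Q p == blk2 Q p).
    exact: aff.
  apply: (vec_inZ FA); first exact: (fun_algebra_const FA).
  by apply: (vec_in_cross FA); apply: aff.
have vec_g s p : vec (g s) p = gv s p by apply/rowP => j; rewrite mxE.
have -> : phi Q x = g 0.
  apply/esym/eq_phi => p; rewrite vec_g /gv /phiv /lam.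
  by rewrite !scale0r !addr0.
apply: (zclosure_curve cg); apply: almost_all_mono (almost_all_neq0 C) => s s0.
pose y := Param (pick_in 0 (lam s))
  (fun p => if blk1 Q p == blk2 Q p then (s * a p)^-1 else par_t x p) (par_u x).
suff -> : g s = phi split_partition y.
  exact: phi_matroid_variety split_partitionP y.
(* The representative is immaterial: a split block is a singleton or a large block, on which [lam s]
   is constant. *)
have lamE i : pick_in 0 (lam s) (pblock split_partition i) = lam s i.
  rewrite pblock_split.
  have [j ji ->] := pick_inP 0 (lam s) (split_label_self i).
  move: ji; rewrite /split_label; case: ifP => Qi.
    by rewrite inE => /eqP->.
  by rewrite (mem_block hQ) ?pblock_in // /lam /v => /eqP->; rewrite Qi.
apply: eq_phi => p; rewrite vec_g /gv /phiv split_blocks /y /= !lamE.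
have [e|//] := eqVneq (blk1 Q p) (blk2 Q p).
rewrite ltnNge; have [B3|nB3] := boolP (#|blk1 Q p| <= 3)%N => /=; last first.
  rewrite /lam /v -/(blk1 Q p) -/(blk2 Q p) -e (negbTE nB3).
  by rewrite cross0l !scaler0 !addr0.
have [a0 /(_ e B3) ea] := ha p.
rewrite /lam -/(blk1 Q p) -/(blk2 Q p) -e.
rewrite cross_perturb ea !scalerDr !scalerA; congr (_ + _ *: _).
  by rewrite [X in X *: _](_ : _ = 1) ?scale1r //; field; rewrite a0.
by field; rewrite a0.
Qed.

End Splitting.

End AdmissibleRefinement.

(** * Admissible partitions: covering and irreducibility *)

Section Admissible.
Variables (C : numFieldType) (n : nat).
Hypothesis n4 : (4 <= n)%N.
Implicit Types (Q : {set {set 'I_n}}) (p q : Pt n) (S T : {set Pt n}).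
Implicit Types (x : param C n) (g : point C (Pt n * 'I_3)%type).

Lemma admissibleP Q : admissible Q <-> partition Q [set: 'I_n] /\
  forall B, B \in Q -> [/\ #|B| != 2, #|B| != 3 & #|B| != n.-1].
Proof.
split=> [/andP[hQ /forall_inP h]|[hQ h]].
  by split=> // B /h /andP[/andP[]].
by rewrite /admissible hQ; apply/forall_inP => B /h[-> -> ->].
Qed.

(** With a block of size [n - 1], merge everything; otherwise splitting leaves singletons and old
    blocks of more than 3 lines. The bound [4 <= n] makes the sizes 1 and [n] admissible. *)
Lemma phi_admissible Q x : partition Q [set: 'I_n] ->
  exists Q', admissible Q' /\ matroid_variety (LQ_circ Q') (phi Q x).
Proof.
move=> hQ; have [/exists_inP[B BQ /eqP Bn]|/exists_inPn noB] :=
    boolP [exists B in Q, #|B| == n.-1].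
  exists [set [set: 'I_n]]; split; last exact: (phi_merge n4 x hQ BQ Bn).
  apply/admissibleP; split; first by case: (partition_setT n4).
  move=> _ /set1P->; rewrite cardsT card_ord.
  by move: n4; case: (n) => [|[|[|[|m]]]] //= _; rewrite gtn_eqF.
exists (split_partition Q); split; last exact: phi_split.
apply/admissibleP; split; first exact: split_partitionP.
move=> _ /imsetP[i _ ->]; rewrite /split_label; case: ifP => Qi.
  by rewrite cards1; move: n4; case: (n) => [|[|[|[|m]]]].
rewrite noB ?pblock_in //; split=> //.
  by apply: contraFneq Qi => ->.
by apply: contraFneq Qi => ->.
Qed.

Lemma independent3 Q p q r : p != q -> q != r -> r != p ->
  (forall B1 B2, B1 \in Q -> B2 \in Q -> B1 != B2 ->
    [/\ ~~ [&& p \in Hb B1, p \in Hb B2, q \in Hb B1 & q \in Hb B2],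
        ~~ [&& q \in Hb B1, q \in Hb B2, r \in Hb B1 & r \in Hb B2] &
        ~~ [&& r \in Hb B1, r \in Hb B2, p \in Hb B1 & p \in Hb B2]]) ->
  (forall B, B \in Q -> ~~ [&& p \in Hb B, q \in Hb B & r \in Hb B]) ->
  #|[set p; q; r]| = 3 /\ ~~ dependent (LQ_circ Q) [set p; q; r].
Proof.
move=> pq qr rp h2 h3; have c3 : #|[set p; q; r]| = 3.
  by rewrite -setUA cardsU1 !inE cards2 qr [p == r]eq_sym (negbTE pq) (negbTE rp).
split=> //; apply/(LQ_independentP Q _).2; rewrite c3; split=> //; last first.
  move=> _ B BQ; apply: contra (h3 B BQ) => sub.
  by rewrite !(subsetP sub) // !inE eqxx ?orbT.
move=> a b B1 B2; rewrite !inE -!orbA => ha hb ab B1Q B2Q B12 [a1 a2 b1 b2].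
have [/negP n1 /negP n2 /negP n3] := h2 B1 B2 B1Q B2Q B12.
move: ab a1 a2 b1 b2.
case/or3P: ha => /eqP->; case/or3P: hb => /eqP->; rewrite ?eqxx // => _ a1 a2 b1 b2;
  by [apply: n1; apply/and4P|apply: n2; apply/and4P|apply: n3; apply/and4P].
Qed.

Lemma mem_Hb_pt Q p i j B : partition Q [set: 'I_n] -> B \in Q -> val p = [set i; j] ->
  (p \in Hb B) = (pblock Q i == B) || (pblock Q j == B).
Proof.
move=> hQ BQ /ends_set2[[e1 e2]|[e1 e2]]; rewrite (mem_Hb hQ) // /blk1 /blk2 e1 e2 //.
exact: orbC.
Qed.

Lemma Pt_neq p q i : i \in val p -> i \notin val q -> p != q.
Proof. by move=> ip; apply: contraNneq => <-. Qed.

(** Shows that two lines in different blocks span no common plane. With a line [k] in a third block,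
    take the triangle of [i], [j], [k]; with only two blocks, take the point of [i] and [j] and one
    further point inside each block. *)
Lemma independent_two_lines Q i j : admissible Q -> pblock Q i != pblock Q j ->
  exists T, [/\ #|T| = 3, ~~ dependent (LQ_circ Q) T & T \subset line i :|: line j].
Proof.
case/admissibleP=> hQ hB bij.
have ij : i != j by apply: contraNneq bij => ->.
have [p pE] := Pt_ex ij.
have [k /andP[ki kj]|all_in] :=
    pickP [pred k | (pblock Q k != pblock Q i) && (pblock Q k != pblock Q j)].
  have ik : i != k by apply: contraNneq ki => ->.
  have jk : j != k by apply: contraNneq kj => ->.
  have [q qE] := Pt_ex ik; have [r rE] := Pt_ex jk.
  exists [set p; q; r].
  have HE B : B \in Q -> ((p \in Hb B) = (pblock Q i == B) || (pblock Q j == B)) *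
      ((q \in Hb B) = (pblock Q i == B) || (pblock Q k == B)) *
      ((r \in Hb B) = (pblock Q j == B) || (pblock Q k == B)).
    by move=> BQ; rewrite (mem_Hb_pt hQ BQ pE) (mem_Hb_pt hQ BQ qE) (mem_Hb_pt hQ BQ rE).
  have [||||| c3 nd] := @independent3 Q p q r; last first.
  + split=> //; apply/subsetP => a; rewrite !inE -orbA => /or3P[]/eqP->;
      by rewrite ?pE ?qE ?rE !inE eqxx ?orbT.
  + move=> B BQ; rewrite !(HE B BQ).
    move: bij ki kj => /eqP ? /eqP ? /eqP ?.
    by repeat case: eqP => //= ?; congruence.
  + move=> B1 B2 B1Q B2Q /eqP ?; rewrite !(HE B1 B1Q, HE B2 B2Q).
    move: bij ki kj => /eqP ? /eqP ? /eqP ?.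
    by split; repeat case: eqP => //= ?; congruence.
  + by apply: (@Pt_neq _ _ k); rewrite ?rE ?pE !inE ?eqxx ?orbT // negb_or ![k == _]eq_sym ik jk.
  + by apply: (@Pt_neq _ _ i); rewrite ?qE ?rE !inE ?eqxx ?orbT // negb_or ij ik.
  + by apply: (@Pt_neq _ _ j); rewrite ?pE ?qE !inE ?eqxx ?orbT // negb_or jk eq_sym ij.
have two k : pblock Q k = pblock Q i \/ pblock Q k = pblock Q j.
  by have := all_in k => /=; do 2 case: eqP => //; auto.
(* If [a] were alone in its block, the other block would have the excluded size [n - 1]. *)
have big a b : pblock Q a != pblock Q b ->
    (forall k, pblock Q k = pblock Q a \/ pblock Q k = pblock Q b) ->
    exists2 c, c != a & pblock Q c = pblock Q a.
  move=> ab two'; apply: contrapT => h.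
  have [_ _ /eqP[]] := hB _ (pblock_in hQ b).
  have -> : pblock Q b = ~: [set a].
    apply/setP => k; rewrite !inE (mem_block hQ) ?pblock_in //.
    apply/idP/idP => [/eqP e|ka]; first by apply: contraNneq ab => <-; rewrite e.
    by have [e|->//] := two' k; case: h; exists k.
  by rewrite cardsC1 card_ord.
have [i' i'i ei] := big i j bij two.
have [|k|j' j'j ej] := big j i; [by rewrite eq_sym|by case: (two k); auto|].
have [q qE] : exists q : Pt n, val q = [set i; i'] by apply: Pt_ex; rewrite eq_sym.
have [r rE] : exists r : Pt n, val r = [set j; j'] by apply: Pt_ex; rewrite eq_sym.
have HE B : B \in Q -> ((p \in Hb B) = (pblock Q i == B) || (pblock Q j == B)) *
    ((q \in Hb B) = (pblock Q i == B)) * ((r \in Hb B) = (pblock Q j == B)).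
  move=> BQ; rewrite (mem_Hb_pt hQ BQ pE) (mem_Hb_pt hQ BQ qE) (mem_Hb_pt hQ BQ rE).
  by rewrite ei ej !orbb.
have i'j : i' != j by apply: contraNneq bij => <-; rewrite ei.
have j'i : j' != i by apply: contraNneq bij => <-; rewrite ej.
exists [set p; q; r].
have [||||| c3 nd] := @independent3 Q p q r; last first.
- split=> //; apply/subsetP => a; rewrite !inE -orbA => /or3P[]/eqP->;
    by rewrite ?pE ?qE ?rE !inE eqxx ?orbT.
- move=> B BQ; rewrite !(HE B BQ).
  move: bij => /eqP ?; by repeat case: eqP => //= ?; congruence.
- move=> B1 B2 B1Q B2Q /eqP ?; rewrite !(HE B1 B1Q, HE B2 B2Q).
  move: bij => /eqP ?; by split; repeat case: eqP => //= ?; congruence.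
- by apply: (@Pt_neq _ _ j'); rewrite ?rE ?pE !inE ?eqxx ?orbT // negb_or j'i j'j.
- by apply: (@Pt_neq _ _ i); rewrite ?qE ?rE !inE ?eqxx ?orbT // negb_or ij eq_sym j'i.
- by apply: (@Pt_neq _ _ j); rewrite ?pE ?qE !inE ?eqxx ?orbT // negb_or ![j == _]eq_sym ij i'j.
Qed.

(** Planes of different blocks are distinct, since otherwise the triple of [independent_two_lines]
    would be coplanar; hence points on two blocks are multiples of the cross product. *)
Lemma realization_phi Q g : admissible Q -> realization (LQ_circ Q) g ->
  exists x : param C n, g = phi Q x.
Proof.
move=> aQ rg; have [hQ _] := (admissibleP Q).1 aQ.
have [lam hlam] : exists lam : {set 'I_n} -> 'rV[C]_3, forall B, B \in Q ->
    lam B != 0 /\ forall p, p \in Hb B -> dot (lam B) (vec g p) = 0.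
  apply: (@fin_all_exists _ _ (fun B l => B \in Q ->
    l != 0 /\ forall p, p \in Hb B -> dot l (vec g p) = 0)) => B.
  have [BQ|] := boolP (B \in Q); last by exists 0.
  have [T TB T3|l l0 hl] := @plane_of_lin_dep _ _ g (Hb B); last by exists l.
  by apply/rg; apply: dependent_Hb TB.
have b1Q p : blk1 Q p \in Q by apply: pblock_in.
have b2Q p : blk2 Q p \in Q by apply: pblock_in.
have b1g p : dot (lam (blk1 Q p)) (vec g p) = 0.
  by apply: (hlam _ (b1Q p)).2; rewrite (mem_Hb hQ) // eqxx.
have b2g p : dot (lam (blk2 Q p)) (vec g p) = 0.
  by apply: (hlam _ (b2Q p)).2; rewrite (mem_Hb hQ) // eqxx orbT.
have [u hu] : exists u : Pt n -> 'rV[C]_3, forall p,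
    cross (lam (blk1 Q p)) (u p) = vec g p.
  apply: (@fin_all_exists _ _ (fun p v => cross (lam (blk1 Q p)) v = vec g p)) => p.
  by apply: dot_solve => //; apply: (hlam _ (b1Q p)).1.
have [t ht] : exists t : Pt n -> C, forall p, blk1 Q p != blk2 Q p ->
    vec g p = t p *: cross (lam (blk1 Q p)) (lam (blk2 Q p)).
  apply: (@fin_all_exists _ _ (fun p k => blk1 Q p != blk2 Q p ->
    vec g p = k *: cross (lam (blk1 Q p)) (lam (blk2 Q p)))) => p.
  have [e|ne] := eqVneq (blk1 Q p) (blk2 Q p); first by exists 0.
  have [|k hk] := ortho_cross _ (b1g p) (b2g p); last by exists k.
  apply/eqP => cr; have [T [T3 ndT sub]] := independent_two_lines aQ ne.
  have [k lk] := cross_eq0 (hlam _ (b2Q p)).1 cr.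
  have /negP[] := ndT; apply/rg.
  apply: (lin_dep_plane (hlam _ (b1Q p)).1); first by rewrite T3.
  move=> q /(subsetP sub) /setUP[qi|qj].
    apply: (hlam _ (b1Q p)).2; apply: (subsetP (line_sub_Hb _)) qi.
    exact: mem_pblock_self.
  rewrite lk dotZl (hlam _ (b2Q p)).2 ?mulr0 //.
  by apply: (subsetP (line_sub_Hb _)) qj; apply: mem_pblock_self.
exists (Param lam t u); apply: eq_phi => p.
by rewrite /phiv /=; case: eqP => [_|/eqP/ht].
Qed.

Lemma matroid_variety_irreducible Q : admissible Q ->
  zirreducible (matroid_variety (C := C) (LQ_circ Q)).
Proof.
move=> aQ; have [hQ _] := (admissibleP Q).1 aQ.
apply: zirreducible_segment.
  by have [x rx] := realizable C hQ; exists (phi Q x).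
move=> v w /(realization_phi aQ)[x ->] /(realization_phi aQ)[y ->].
exists (fun s => phi Q (seg x y s)); split.
- exact: curve_phi.
- by exists 0; rewrite seg0.
- by exists 1; rewrite seg1.
- by move=> s; apply: phi_matroid_variety.
Qed.

End Admissible.

(** * Irredundancy through the quadrilateral-set relation *)

Section Irredundant.
Variables (C : numFieldType) (n : nat).
Implicit Types (Q : {set {set 'I_n}}) (p q : Pt n) (S T : {set Pt n}).
Implicit Types (x : param C n) (g : point C (Pt n * 'I_3)%type).

(** The determinant of [z] and the two vectors, that is, the bracket of their projections from
    [z]. *)
Definition bracket (z : 'rV[C]_3) g p q : C := dot z (cross (vec g p) (vec g q)).

Lemma regular_bracket z p q : regular (fun g => bracket z g p q).
Proof.
have FA := regular_algebra C (Pt n * 'I_3)%type.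
have vecF r : vec_in (@regular C (Pt n * 'I_3)%type) (fun g => vec g r).
  move=> k; have -> : (fun g => vec g r 0 k) =
      (fun g : point C (Pt n * 'I_3)%type => g (r, k)).
    by apply/funext => g; rewrite mxE.
  exact: regular_coord.
by apply: (fun_algebra_dot FA); [exact: (vec_in_const FA)|exact: (vec_in_cross FA)].
Qed.

Definition quadrilateral_defect z g (p12 p13 p14 p23 p24 p34 : Pt n) : C :=
  bracket z g p23 p13 * bracket z g p34 p14 * bracket z g p24 p12 -
  bracket z g p23 p12 * bracket z g p34 p13 * bracket z g p24 p14.

Lemma regular_quadrilateral_defect z p12 p13 p14 p23 p24 p34 :
  regular (fun g => quadrilateral_defect z g p12 p13 p14 p23 p24 p34).
Proof.
have FA := regular_algebra C (Pt n * 'I_3)%type.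
have FM f1 f2 f3 : regular f1 -> regular f2 -> regular f3 ->
    regular (fun g : point C (Pt n * 'I_3)%type => f1 g * f2 g * f3 g).
  move=> h1 h2 h3; apply: (fun_algebraM FA) => //.
  exact: (fun_algebraM FA).
apply: (fun_algebraD FA); last apply: (fun_algebraN FA).
  by apply: FM; apply: regular_bracket.
by apply: FM; apply: regular_bracket.
Qed.

Section Quadrilateral.
Variables (i1 i2 i3 i4 : 'I_n) (p12 p13 p14 p23 p24 p34 : Pt n).
Hypotheses (E12 : val p12 = [set i1; i2]) (E13 : val p13 = [set i1; i3])
  (E14 : val p14 = [set i1; i4]) (E23 : val p23 = [set i2; i3])
  (E24 : val p24 = [set i2; i4]) (E34 : val p34 = [set i3; i4]).

Lemma phiv_pair Q x p i j : val p = [set i; j] -> pblock Q i != pblock Q j ->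
  exists t, phiv Q x p = t *: cross (par_lam x (pblock Q i)) (par_lam x (pblock Q j)).
Proof.
move=> /ends_set2[[e1 e2]|[e1 e2]] /negbTE ne; rewrite /phiv /blk1 /blk2 e1 e2.
  by rewrite ne; exists (par_t x p).
by rewrite eq_sym ne; exists (- par_t x p); rewrite crossC scalerN scaleNr.
Qed.

Lemma quadrilateral_phi Q x z :
  uniq [:: pblock Q i1; pblock Q i2; pblock Q i3; pblock Q i4] ->
  quadrilateral_defect z (phi Q x) p12 p13 p14 p23 p24 p34 = 0.
Proof.
rewrite /= !inE !negb_or => /and4P[/and3P[n12 n13 n14] /andP[n23 n24] n34 _].
rewrite /quadrilateral_defect /bracket !vec_phi.
have [t12 ->] := phiv_pair x E12 n12; have [t13 ->] := phiv_pair x E13 n13.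
have [t14 ->] := phiv_pair x E14 n14; have [t23 ->] := phiv_pair x E23 n23.
have [t24 ->] := phiv_pair x E24 n24; have [t34 ->] := phiv_pair x E34 n34.
by apply/eqP; rewrite subr_eq0; apply/eqP; apply: quadrilateral_relation.
Qed.

Lemma quadrilateral_block Q B : partition Q [set: 'I_n] -> B \in Q ->
  uniq [:: i1; i2; i3; i4] -> {subset [:: i1; i2; i3; i4] <= B} ->
  exists z x, quadrilateral_defect z (phi Q x) p12 p13 p14 p23 p24 p34 != 0.
Proof.
move=> hQ BQ; rewrite /= !inE !negb_or => /and4P[/and3P[n12 n13 n14] /andP[n23 n24] n34 _] sub.
pose e k : 'rV[C]_3 := delta_mx 0 k.
have e00 : e 0 != 0 by apply/eqP => /rowP/(_ 0); rewrite !mxE eqxx => /eqP; rewrite oner_eq0.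
have [w1 hw1] : exists w, cross (e 0) w = e 1.
  by apply: dot_solve => //; rewrite dot_delta mxE.
have [w2 hw2] : exists w, cross (e 0) w = e 2%:R.
  by apply: dot_solve => //; rewrite dot_delta mxE.
(* In the plane orthogonal to [e 0], the points 12, 23, 34 become [e 1] and the points 13, 14, 24
   become [e 2%:R]. The first product of brackets is then -1, and the second contains the bracket of
   23 and 12, which is 0. *)
pose x := Param (fun=> e 0) (fun=> 0)
  (fun p => if p \in [:: p12; p23; p34] then w1 else w2).
exists (e 0), x.
have blkB p i j : val p = [set i; j] -> i \in B -> j \in B ->
    blk1 Q p = B /\ blk2 Q p = B.
  move=> pE iB jB; have : val p \subset B by rewrite pE subUset !sub1set iB.
  by rewrite val_sub_ends !(mem_block hQ) // => /andP[/eqP ? /eqP ?].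
have hv p i j : val p = [set i; j] -> i \in B -> j \in B ->
    vec (phi Q x) p = if p \in [:: p12; p23; p34] then e 1 else e 2%:R.
  move=> pE iB jB; have [b1 b2] := blkB p i j pE iB jB.
  by rewrite vec_phi /phiv b1 b2 eqxx /=; case: ifP.
have [h1 h2 h3 h4] : [/\ i1 \in B, i2 \in B, i3 \in B & i4 \in B].
  by split; apply: sub; rewrite !inE eqxx ?orbT.
have neqp (p q : Pt n) i : i \in val p -> i \notin val q -> p == q = false.
  by move=> ip iq; apply: negbTE; apply: Pt_neq iq.
have sym (a b : 'I_n) : a != b -> b != a by rewrite eq_sym.
have n21 := sym _ _ n12; have n31 := sym _ _ n13; have n41 := sym _ _ n14.
have n32 := sym _ _ n23; have n42 := sym _ _ n24; have n43 := sym _ _ n34.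
have notin p i j : val p = [set i; j] ->
    (i \notin val p12) || (j \notin val p12) ->
    (i \notin val p23) || (j \notin val p23) ->
    (i \notin val p34) || (j \notin val p34) -> p \in [:: p12; p23; p34] = false.
  move=> pE; have ip : i \in val p by rewrite pE set21.
  have jp : j \in val p by rewrite pE set22.
  have ne q : (i \notin val q) || (j \notin val q) -> (p == q) = false.
    by case/orP; [apply: neqp ip|apply: neqp jp].
  by move=> /ne h12 /ne h23 /ne h34; rewrite !inE h12 h23 h34.
have [m12 m23 m34] : [/\ p12 \in [:: p12; p23; p34], p23 \in [:: p12; p23; p34]
    & p34 \in [:: p12; p23; p34]] by rewrite !inE !eqxx ?orbT.
have m13 : p13 \in [:: p12; p23; p34] = false.
  apply: (notin _ _ _ E13); rewrite ?E12 ?E23 ?E34 !inE !negb_or;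
  by rewrite ?(n12, n13, n14, n23, n24, n34, n21, n31, n41, n32, n42, n43) ?orbT.
have m14 : p14 \in [:: p12; p23; p34] = false.
  apply: (notin _ _ _ E14); rewrite ?E12 ?E23 ?E34 !inE !negb_or;
  by rewrite ?(n12, n13, n14, n23, n24, n34, n21, n31, n41, n32, n42, n43) ?orbT.
have m24 : p24 \in [:: p12; p23; p34] = false.
  apply: (notin _ _ _ E24); rewrite ?E12 ?E23 ?E34 !inE !negb_or;
  by rewrite ?(n12, n13, n14, n23, n24, n34, n21, n31, n41, n32, n42, n43) ?orbT.
rewrite /quadrilateral_defect /bracket.
rewrite (hv _ _ _ E12) // (hv _ _ _ E13) // (hv _ _ _ E14) // (hv _ _ _ E23) //.
rewrite (hv _ _ _ E24) // (hv _ _ _ E34) // m12 m13 m14 m23 m24 m34.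
rewrite cross_self [cross (e 2%:R) _]crossC dotNr.
have -> : dot (e 0) (cross (e 1) (e 2%:R)) = 1.
  by rewrite dotC dot_delta crossE /e !mxE /= mulr1 mulr0 subr0.
have -> : dot (e 0) 0 = 0 by rewrite dotE !mxE !mulr0 !addr0.
by rewrite !mul0r subr0 !mul1r oppr_eq0 oner_eq0.
Qed.
End Quadrilateral.

Lemma matroid_variety_not_sub Q Q' :
  (4 <= n)%N -> admissible Q -> admissible Q' -> Q != Q' ->
  ~ (forall g, matroid_variety (LQ_circ Q) g -> matroid_variety (LQ_circ Q') g).
Proof.
move=> n4 aQ aQ' neQ sub.
have [hQ sizeQ] := (admissibleP Q).1 aQ; have [hQ' _] := (admissibleP Q').1 aQ'.
have [x rx] := realizable C hQ.
(* A realization of [L_n(Q)] lies in the variety of [Q'], so it has all dependences of [Q']. *)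
have weak S : dependent (LQ_circ Q') S -> dependent (LQ_circ Q) S.
  move=> dS; apply/rx; apply: matroid_variety_lin_dep dS.
  exact: (sub _ (zclosureW rx)).
have refines i j : pblock Q' i = pblock Q' j -> pblock Q i = pblock Q j.
  move=> e; apply/eqP; apply: contraT => /(independent_two_lines aQ)[T [T3 ndT sT]].
  case/negP: ndT; apply/weak/(dependent_Hb (pblock_in hQ' i) T3).
  apply: subset_trans sT _; rewrite subUset !line_sub_Hb ?mem_pblock_self //.
  by rewrite e mem_pblock_self.
have [i [j [eij neij]]] : exists i j,
    pblock Q i = pblock Q j /\ pblock Q' i <> pblock Q' j.
  apply: contrapT => h.
  have e i : pblock Q i = pblock Q' i.
    apply/setP => j; rewrite (mem_block hQ _ (pblock_in hQ i)) (mem_block hQ' _ (pblock_in hQ' i)).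
    apply/idP/idP => /eqP e; last by apply/eqP/refines.
    by apply/eqP; apply: contrapT => ne; apply: h; exists j, i.
  case/eqP: neQ; apply/setP => B.
  have QE (P : {set {set 'I_n}}) : partition P [set: 'I_n] ->
      (B \in P) = [exists i, B == pblock P i].
    move=> hP; apply/idP/existsP => [BP|[k /eqP->]]; last exact: pblock_in.
    have [k kB] : exists k, k \in B.
      by apply/set0Pn; case/and3P: hP => _ _; apply: contraNneq => <-.
    by exists k; move: kB; rewrite (mem_block hP) // eq_sym.
  by rewrite !QE //; apply: eq_existsb => k; rewrite e.
pose B := pblock Q i; have BQ : B \in Q by apply: pblock_in.
have iB : i \in B by apply: mem_pblock_self.
have jB : j \in B by rewrite (mem_block hQ) // -eij.
(* If [Q'] kept [a] and [b] together but separated [c], the points of [c] with [a] and with [b]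
   would form a Type 1 pair for [Q'], although they are independent inside the block [B] of [Q]. *)
have inj' : {in B &, injective (pblock Q')}.
  move=> a b aB bB eab; apply/eqP; apply: contraT => nab.
  have [c [cB nc]] : exists c, c \in B /\ pblock Q' c <> pblock Q' a.
    have [e|ne] := pselect (pblock Q' i = pblock Q' a).
      by exists j; split=> // e'; apply: neij; rewrite e e'.
    by exists i.
  have ac : a != c by apply/eqP => e; rewrite e in nc.
  have bc : b != c by apply/eqP => e; rewrite eab e in nc.
  have [p pE] := Pt_ex ac; have [q qE] := Pt_ex bc.
  have pq : p != q.
    by apply: (@Pt_neq _ _ _ a); rewrite ?pE ?qE !inE ?eqxx // negb_or nab.
  have blkp : blk1 Q p = B /\ blk2 Q p = B.
    have : val p \subset B by rewrite pE subUset !sub1set aB.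
    by rewrite val_sub_ends !(mem_block hQ) // => /andP[/eqP ? /eqP ?].
  have /negP[] := independent_pair hQ blkp.1 blkp.2 pq.
  apply/weak; apply: contraT => /(LQ_independentP Q' _).1[_ h2 _].
  case: (h2 p q (pblock Q' a) (pblock Q' c)); rewrite ?inE ?eqxx ?orbT ?pblock_in //.
    by apply/eqP => e; case: nc.
  by split; rewrite ?(mem_Hb_pt hQ' _ pE) ?(mem_Hb_pt hQ' _ qE) ?pblock_in // ?eab eqxx ?orbT.
(* [B] contains [i] and [j], and sizes 2 and 3 are excluded, so four lines are available. *)
have [T [TB T4]] : exists T : {set 'I_n}, T \subset B /\ #|T| = 4.
  apply: card_subset_ex; have [] := sizeQ B BQ.
  have : (1 < #|B|)%N.
    have : [set i; j] \subset B by rewrite subUset !sub1set iB.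
    move/subset_leq_card; rewrite cards2; case: eqP => // e.
    by case: neij; rewrite e.
  by case: #|B| => [|[|[|[|]]]].
move: (mem_enum T) (enum_uniq T) (cardE T); rewrite T4.
case: (enum T) => [|i1 [|i2 [|i3 [|i4 [|]]]]] //= memT uT _.
have sB : {subset [:: i1; i2; i3; i4] <= B}.
  by move=> k kT; apply: (subsetP TB); rewrite -memT.
have := uT; rewrite !inE !negb_or => /and4P[/and3P[n12 n13 n14] /andP[n23 n24] n34 _].
have [p12 E12] := Pt_ex n12; have [p13 E13] := Pt_ex n13; have [p14 E14] := Pt_ex n14.
have [p23 E23] := Pt_ex n23; have [p24 E24] := Pt_ex n24; have [p34 E34] := Pt_ex n34.
have [z [y /eqP[]]] := quadrilateral_block E12 E13 E14 E23 E24 E34 hQ BQ uT sB.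
(* The defect vanishes on realizations of [Q'], hence on their closure, but not at [phi Q y]. *)
have closed : zclosed (fun g => forall _ : unit,
    quadrilateral_defect z g p12 p13 p14 p23 p24 p34 = 0).
  by apply: zclosed_regular => _; apply: regular_quadrilateral_defect.
apply: (zclosureS closed _ (sub _ (phi_matroid_variety hQ y)) tt) => w.
case/(realization_phi aQ')=> x' -> _.
apply: (quadrilateral_phi E12 E13 E14 E23 E24 E34).
have : uniq (map (pblock Q') [:: i1; i2; i3; i4]) by
  rewrite map_inj_in_uniq // => a b /sB aB /sB bB; apply: inj'.
exact.
Qed.

End Irredundant.

(** * The decomposition over the complex numbers [R[i]] *)

Theorem theorem6p5 (R : realType) (n : nat) (hn : (4 <= n)%N) :
  (forall g : point R[i] (Pt n * 'I_3)%type,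
     circuit_variety (@Ln_circ n) g <->
     exists Q : {set {set 'I_n}}, admissible Q /\ matroid_variety (LQ_circ Q) g)
  /\ (forall Q : {set {set 'I_n}}, admissible Q ->
        zirreducible (matroid_variety (C := R[i]) (LQ_circ Q)))
  /\ (forall Q Q' : {set {set 'I_n}}, admissible Q -> admissible Q' -> Q != Q' ->
        ~ (forall g : point R[i] (Pt n * 'I_3)%type,
             matroid_variety (LQ_circ Q) g -> matroid_variety (LQ_circ Q') g)).
Proof.
split=> [g|]; last split=> [Q|Q Q'].
- split=> [/circuit_variety_phi[Q [x [hQ ->]]]|[Q [aQ]]].
    exact: phi_admissible.
  have [hQ _] := (admissibleP Q).1 aQ.
  exact: matroid_variety_circuit_variety.
- exact: matroid_variety_irreducible.
- exact: matroid_variety_not_sub.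
Qed.
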